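(* Let $\diamondsuit\in\mathcal{F}$ be a symmetrization on $\mathcal{K}^n$. If $(H_m)_{m\in\mathbb{N}}$ is a $\diamondsuit$-stable sequence of subspaces of $\mathbb{R}^n$, then $(H_m)$ is $\spadesuit$-stable for every symmetrization $\spadesuit\in\mathcal{F}$. In particular, this holds for Steiner and Minkowski symmetrizations when the $H_m$ are hyperplanes; that is, a sequence of hyperplanes is stable on $\mathcal{K}^n$ for Steiner symmetrization if and only if it is stable on $\mathcal{K}^n$ for Minkowski symmetrization.
   Context: $\mathcal{K}^n$ is the family of nonempty compact convex subsets of $\mathbb{R}^n$, equipped with the Hausdorff distance; convergence of sets is in this distance. ''Subspace'' means linear subspace of dimension $i$ with $1\le i\le n-1$; a hyperplane is a subspace of dimension $n-1$. For a subspace $H$, $H^\perp$ is its orthogonal complement, $P_{H^\perp}$ is orthogonal projection onto $H^\perp$, and $R_H(x)=x-2P_{H^\perp}x$ is the reflection with respect to $H$. A set $A$ is $H$-symmetric if $R_HA=A$. $A+B=\{a+b: a\in A,\ b\in B\}$ is the Minkowski sum. An $H$-symmetrization on $\mathcal{K}^n$ is a map $\diamondsuit_H:\mathcal{K}^n\to\{K\in\mathcal{K}^n: R_HK=K\}$. A symmetrization $\diamondsuit$ on $\mathcal{K}^n$ assigns to every subspace $H$ an $H$-symmetrization $\diamondsuit_H$. $\mathcal{F}$ is the family of all symmetrizations $\diamondsuit$ on $\mathcal{K}^n$ such that for every subspace $H$: (monotonicity) $K\subseteq L$ implies $\diamondsuit_HK\subseteq\diamondsuit_HL$ for all $K,L\in\mathcal{K}^n$;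 ($H^\perp$-translation invariance for $H$-symmetric sets) if $K\in\mathcal{K}^n$ and $R_HK=K$, then $\diamondsuit_H(K+x)=K$ for every $x\in H^\perp$; (invariance for $H$-symmetric sets) if $K\in\mathcal{K}^n$ and $R_HK=K$, then $\diamondsuit_HK=K$. A sequence of subspaces $(H_m)$ is $\diamondsuit$-stable (stable for $\diamondsuit$) on $\mathcal{K}^n$ if for every $k\in\mathbb{N}$ and every $K\in\mathcal{K}^n$ the sequence $\diamondsuit_{H_m}\cdots\diamondsuit_{H_{k+1}}\diamondsuit_{H_k}K$, $m\ge k$, converges (the limit may depend on $K$ and $k$). Minkowski symmetrization: $M_HK=\frac{K+R_HK}{2}$. Steiner symmetrization with respect to a hyperplane $H$: $S_HK$ is the union over $x\in H$ with $K\cap(H^\perp+x)\neq\emptyset$ of the closed segment (or point) in $H^\perp+x$ centered at $x$ having the same length as $K\cap(H^\perp+x)$. *)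

(* Defs.v *)
From HB Require Import structures.
From mathcomp Require Import all_boot all_order all_algebra.
From mathcomp Require Import all_classical all_reals all_analysis.
Import Order.TTheory GRing.Theory Num.Theory.
Import numFieldNormedType.Exports.

Set Implicit Arguments.
Unset Strict Implicit.
Unset Printing Implicit Defensive.

Local Open Scope classical_set_scope.
Local Open Scope ring_scope.

(* The norm that MathComp-Analysis puts on 'rV[R]_n is the sup norm, so the
   Euclidean structure is introduced separately; both induce the same topology,
   hence the same compact sets. *)
Section Euclidean.
Variables (R : realType) (n : nat).
Implicit Types u v : 'rV[R]_n.

Definition dot u v : R := \sum_(i < n) u 0 i * v 0 i.

Fact dot_linearl v : linear_for *%R (dot^~ v).
Proof.
move=> a x y; rewrite /dot mulr_sumr -big_split /=.
by apply: eq_bigr => i _; rewrite !mxE mulrDl mulrA.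
Qed.

Fact dot_linearr u : linear_for *%R (dot u).
Proof.
move=> a x y; rewrite /dot mulr_sumr -big_split /=.
by apply: eq_bigr => i _; rewrite !mxE mulrDr mulrCA.
Qed.

HB.instance Definition _ := bilinear_isBilinear.Build R 'rV[R]_n 'rV[R]_n R
  *%R *%R dot (conj dot_linearl dot_linearr).

Fact dot_sym u v : dot u v = (-1) ^+ false * idfun (dot v u).
Proof.
by rewrite expr0 mul1r /dot; apply: eq_bigr => i _; rewrite mulrC.
Qed.

HB.instance Definition _ :=
  isHermitianSesquilinear.Build R 'rV[R]_n false idfun dot dot_sym.

Definition enorm u : R := Num.sqrt (dot u u).

Definition perp (H : {vspace 'rV[R]_n}) : {vspace 'rV[R]_n} :=
  orthov (dot : {hermitian 'rV[R]_n for false & idfun}) H.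

(* As H and perp H are complementary, this is the projection onto perp H
   along H. *)
Definition proj_perp (H : {vspace 'rV[R]_n}) : 'End('rV[R]_n) :=
  daddv_pi (perp H) H.

Definition reflection (H : {vspace 'rV[R]_n}) u : 'rV[R]_n :=
  u - 2 *: proj_perp H u.

End Euclidean.

Section ConvexBodies.
Variables (R : realType) (n : nat).
Implicit Types (A B K L : set 'rV[R]_n) (H : {vspace 'rV[R]_n}).

Definition proper_subspace H : Prop := (1 <= \dim H <= n.-1)%N.

Definition hyperplane H : Prop := proper_subspace H /\ \dim H = n.-1.

Definition convex_body K : Prop :=
  [/\ K !=set0, compact K & convex_set (K : set (convex_lmodType 'rV[R]_n))].

Definition msum A B : set 'rV[R]_n := [set a + b | a in A & b in B].

Definition eball (r : R) : set 'rV[R]_n := [set x | enorm x <= r].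

Definition hausdorff_distance K L : R :=
  inf [set r | [/\ 0 <= r, K `<=` msum L (eball r) & L `<=` msum K (eball r)]].

Definition converges_to (u : nat -> set 'rV[R]_n) L : Prop :=
  hausdorff_distance (u m) L @[m --> \oo] --> (0 : R).

Definition symmetric_wrt H A : Prop := reflection H @` A = A.

End ConvexBodies.

Section Symmetrizations.
Variables (R : realType) (n : nat).

(* Symmetrizations are represented by total functions; only their values at
   proper subspaces and convex bodies are ever constrained or used. *)
Definition set_operation : Type :=
  {vspace 'rV[R]_n} -> set 'rV[R]_n -> set 'rV[R]_n.

Implicit Types (D : set_operation) (H : {vspace 'rV[R]_n})
  (K L : set 'rV[R]_n).

Definition symmetrization D : Prop :=
  forall H, proper_subspace H -> forall K, convex_body K ->
    convex_body (D H K) /\ symmetric_wrt H (D H K).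

Definition monotone_at D H : Prop :=
  forall K L, convex_body K -> convex_body L -> K `<=` L -> D H K `<=` D H L.

Definition perp_translation_invariant_at D H : Prop :=
  forall K, convex_body K -> symmetric_wrt H K ->
    forall x, x \in perp H -> D H [set y + x | y in K] = K.

Definition invariant_at D H : Prop :=
  forall K, convex_body K -> symmetric_wrt H K -> D H K = K.

Definition family_F D : Prop :=
  symmetrization D /\
  forall H, proper_subspace H ->
    [/\ monotone_at D H, perp_translation_invariant_at D H & invariant_at D H].

(* D_{H_{k+j}} ... D_{H_{k+1}} D_{H_k} K *)
Fixpoint successive D (Hs : nat -> {vspace 'rV[R]_n}) (k : nat) K (j : nat)
    : set 'rV[R]_n :=
  if j is j'.+1 then D (Hs (k + j)%N) (successive D Hs k K j') else D (Hs k) K.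

Definition stable D (Hs : nat -> {vspace 'rV[R]_n}) : Prop :=
  forall k K, convex_body K ->
    exists2 L, convex_body L & converges_to (successive D Hs k K) L.

Definition minkowski_symmetral : set_operation := fun H K =>
  [set 2^-1 *: x | x in msum K (reflection H @` K)].

(* For a convex body K and a hyperplane H, the section below is a segment, so
   that its length is its diameter. *)
Definition perp_section H K (x : 'rV[R]_n) : set 'rV[R]_n :=
  K `&` [set y | y - x \in perp H].

Definition diameter (A : set 'rV[R]_n) : R :=
  sup [set enorm (p - q) | p in A & q in A].

(* Steiner symmetrization when H is a hyperplane; meaningless otherwise. *)
Definition steiner_symmetral : set_operation := fun H K =>
  [set y | exists x, [/\ x \in H, perp_section H K x !=set0, y - x \in perp H
    & enorm (y - x) <= diameter (perp_section H K x) / 2]].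

End Symmetrizations.

Arguments minkowski_symmetral {R n}.
Arguments steiner_symmetral {R n}.

(* Main.v *)
From mathcomp Require Import all_boot all_order all_algebra.
From mathcomp Require Import all_classical all_reals all_analysis.
From mathcomp Require Import ring lra.
Require Import Defs.
Import Order.TTheory GRing.Theory Num.Theory.
Import numFieldNormedType.Exports.

Set Implicit Arguments.
Unset Strict Implicit.
Unset Printing Implicit Defensive.

Local Open Scope classical_set_scope.
Local Open Scope ring_scope.

(** Every symmetrization [D] of the family lies between two explicit ones. On the
    one hand, [K] is contained, up to a translation along [perp H], in H-symmetric
    intersections of two halfspaces; so the support function of [D H K] is at most
    the average of that of [K] over [id] and the reflection [R_H], which is the
    support function of the Minkowski symmetral ([family_support]). On the other
    hand, [D H K] contains [(p + R_H q) / 2] whenever [p] and [q] are points of [K]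
    with [p - q] in [perp H] ([family_segment]). The theorem follows by proving
    that, for any member of the family, stability of [(H_m)] is equivalent to a
    statement in which the symmetrization no longer occurs: the linear averaging
    operators [averages Hs k m], applied to any support function, converge
    uniformly on the unit sphere as [m] grows, for every [k].

    Averages converge, hence [D] is stable ([stable_of_cauchy_averages]). Let
    [f_m] be the support function of the [m]-th body of the process. By the upper
    bound, the limits [g_m] of the averages of [f_m] from time [m] on decrease with
    [m], and [f_m] is eventually at most [lim g_m + eps]. The nonnegative
    difference has small averages. Averages over a fixed finite net of the sphere
    control the supremum of a nonnegative Lipschitz function, because reflections
    map nets to nets ([le_sum_averages]); so [f_m] converges, and bodies with
    convergent support functions converge ([body_complete]).

    [D] is stable, hence averages converge ([cauchy_averages_support]). To first
    order the members of the family agree near the ball: if [f] changes under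
    averaging by a function with Lipschitz constant [eta], then [D H] maps the
    sublevel set of [(|x|^2 - 1) / 2 + f] to that of [(|x|^2 - 1) / 2 + average H f],
    up to [O(eta^2)] in the level ([family_sublevel_sub], [family_sublevel_sup]).
    If [f] lies in a finite-dimensional space of functions with an invariant
    Euclidean norm, averaging takes the midpoint of two vectors of equal norm, so
    the squares of the steps are summable, and so are the errors ([tame_averages]). Starting the process at
    [eps f], all bodies are determined by the averages of [eps f] up to [O(eps^2)],
    so convergence of the bodies for every [eps] makes the averages of [f] Cauchy
    ([tame_cauchy]). Polynomials are such functions, and they approximate maxima
    of linear functions, hence support functions ([approximable_support]).

    Minkowski symmetrization belongs to the family. Steiner symmetrization is only
    defined for hyperplanes, where it coincides with the symmetrization
    [fiber_symmetral], which is defined for all subspaces and belongs to the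
    family. *)

(** * The Euclidean norm and its topology *)

Section EuclideanNorm.
Variables (R : realType) (n : nat).
Implicit Types (x y u v w : 'rV[R]_n) (c : R).

Lemma dotC x y : dot x y = dot y x.
Proof. by rewrite /dot; apply: eq_bigr => i _; rewrite mulrC. Qed.

Lemma dotDl x y u : dot (x + y) u = dot x u + dot y u.
Proof. by rewrite /dot -big_split; apply: eq_bigr => i _; rewrite mxE mulrDl. Qed.

Lemma dotZl c x u : dot (c *: x) u = c * dot x u.
Proof. by rewrite /dot mulr_sumr; apply: eq_bigr => i _; rewrite mxE mulrA. Qed.

Lemma dotNl x u : dot (- x) u = - dot x u.
Proof. by rewrite -scaleN1r dotZl mulN1r. Qed.

Lemma dotBl x y u : dot (x - y) u = dot x u - dot y u.
Proof. by rewrite dotDl dotNl. Qed.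

Lemma dotDr u x y : dot u (x + y) = dot u x + dot u y.
Proof. by rewrite ![dot u _]dotC dotDl. Qed.

Lemma dotZr c u x : dot u (c *: x) = c * dot u x.
Proof. by rewrite ![dot u _]dotC dotZl. Qed.

Lemma dotNr u x : dot u (- x) = - dot u x.
Proof. by rewrite ![dot u _]dotC dotNl. Qed.

Lemma dotBr u x y : dot u (x - y) = dot u x - dot u y.
Proof. by rewrite ![dot u _]dotC dotBl. Qed.

Lemma dot0l u : dot 0 u = 0.
Proof. by rewrite -(scale0r 0) dotZl mul0r. Qed.

Lemma dot0r u : dot u 0 = 0.
Proof. by rewrite dotC dot0l. Qed.

Definition dotE := (dotDl, dotDr, dotNl, dotNr, dotZl, dotZr).

Lemma dot_ge0 x : 0 <= dot x x.
Proof. by rewrite /dot sumr_ge0 // => i _; rewrite -expr2 sqr_ge0. Qed.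

Lemma dot_eq0 x : dot x x = 0 -> x = 0.
Proof.
move=> /eqP; rewrite /dot psumr_eq0 => [/allP h|i _]; last first.
  by rewrite -expr2 sqr_ge0.
apply/rowP => i; have := h i (mem_index_enum _).
by rewrite -expr2 sqrf_eq0 mxE => /eqP.
Qed.

Lemma enorm_ge0 x : 0 <= enorm x.
Proof. exact: sqrtr_ge0. Qed.

Lemma sqr_enorm x : enorm x ^+ 2 = dot x x.
Proof. by rewrite sqr_sqrtr // dot_ge0. Qed.

Lemma enorm0 : enorm (0 : 'rV[R]_n) = 0.
Proof. by rewrite /enorm dot0l sqrtr0. Qed.

Lemma enorm_eq0 x : enorm x = 0 -> x = 0.
Proof. by move=> x0; apply: dot_eq0; rewrite -sqr_enorm x0 expr0n. Qed.

Lemma enormN x : enorm (- x) = enorm x.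
Proof. by rewrite /enorm dotNl dotNr opprK. Qed.

Lemma enormC x y : enorm (x - y) = enorm (y - x).
Proof. by rewrite -enormN opprB. Qed.

Lemma enormZ c x : enorm (c *: x) = `|c| * enorm x.
Proof.
by rewrite /enorm dotZl dotZr mulrA -expr2 sqrtrM ?sqr_ge0 // sqrtr_sqr.
Qed.

Lemma dot_le_enorm x y : dot x y <= enorm x * enorm y.
Proof.
have [x0|x0] := eqVneq (enorm x) 0.
  by rewrite (enorm_eq0 x0) dot0l enorm0 mul0r.
have [y0|y0] := eqVneq (enorm y) 0.
  by rewrite (enorm_eq0 y0) dot0r enorm0 mulr0.
have := dot_ge0 (enorm y *: x - enorm x *: y).
have -> : dot (enorm y *: x - enorm x *: y) (enorm y *: x - enorm x *: y) =
    2 * (enorm x * enorm y) * (enorm x * enorm y - dot x y).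
  rewrite !dotE [dot y x]dotC -!sqr_enorm; ring.
have xy : 0 < 2 * (enorm x * enorm y).
  by rewrite !mulr_gt0 // lt_def enorm_ge0 ?x0 ?y0.
by rewrite pmulr_rge0 // subr_ge0.
Qed.

Lemma ler_enormD x y : enorm (x + y) <= enorm x + enorm y.
Proof.
rewrite -(@ler_pXn2r R 2) // ?nnegrE ?addr_ge0 ?enorm_ge0 //.
rewrite sqr_enorm sqrrD !sqr_enorm !dotE [dot y x]dotC.
have := dot_le_enorm x y; lra.
Qed.

Lemma ler_enormB x y : enorm (x - y) <= enorm x + enorm y.
Proof. by rewrite -(enormN y) ler_enormD. Qed.

Lemma enorm_triangle z x y : enorm (x - y) <= enorm (x - z) + enorm (z - y).
Proof. by have := ler_enormD (x - z) (z - y); rewrite subrKA. Qed.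

Lemma enorm_le_sqr x c : 0 <= c -> dot x x <= c ^+ 2 -> enorm x <= c.
Proof. by move=> c0 h; rewrite -(ger0_norm c0) -sqrtr_sqr ler_wsqrtr. Qed.

Lemma unit_vector u : u != 0 -> enorm ((enorm u)^-1 *: u) = 1.
Proof.
move=> u0; rewrite enormZ gtr0_norm ?mulVf //.
  by apply: contraNneq u0 => /enorm_eq0 ->.
by rewrite invr_gt0 lt_def enorm_ge0 andbT; apply: contraNneq u0 => /enorm_eq0 ->.
Qed.

Lemma dotl_continuous u : continuous (fun x => dot x u).
Proof.
apply: (@continuous_big _ _ +%R 0 xpredT add_continuous _ _
  (fun i x => x ord0 i * u ord0 i)) => i _ x.
exact: (cvgM (@coord_continuous R 1 n ord0 i x) (cvg_cst _)).
Qed.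

Lemma dotxx_continuous : continuous (fun x => dot x x).
Proof.
apply: (@continuous_big _ _ +%R 0 xpredT add_continuous _ _
  (fun i x => x ord0 i * x ord0 i)) => i _ x.
exact: (cvgM (@coord_continuous R 1 n ord0 i x)
  (@coord_continuous R 1 n ord0 i x)).
Qed.

Lemma enorm_continuous : continuous (fun x => enorm x).
Proof.
move=> x; exact: (continuous_comp (@dotxx_continuous x) (@sqrt_continuous R _)).
Qed.

Lemma enormB_continuous v : continuous (fun x => enorm (x - v)).
Proof.
move=> x; have cB : {for x, continuous (fun y => y - v)}.
  exact: (cvgB cvg_id (cvg_cst v)).
exact: (continuous_comp cB (@enorm_continuous _)).
Qed.

Lemma closed_sublevel (f : 'rV[R]_n -> R) c :
  continuous f -> closed [set x | f x <= c].
Proof.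
move=> cf; apply: (@preimage_closed _ _ f [set y | y <= c]); last exact: closed_le.
by move=> x _; exact: cf.
Qed.

Lemma coord_le_enorm x i : `|x ord0 i| <= enorm x.
Proof.
rewrite -sqrtr_sqr /enorm ler_wsqrtr // /dot (bigD1 i) //= expr2 lerDl.
by rewrite sumr_ge0 // => j _; rewrite -expr2 sqr_ge0.
Qed.

Lemma norm_le_enorm x : `|x| <= enorm x.
Proof.
rewrite [leLHS]/Num.norm /= mx_normrE; apply/bigmax_leP; split; first exact: enorm_ge0.
by move=> [i j] _ /=; rewrite ord1; exact: coord_le_enorm.
Qed.

Lemma near_enorm_lt v c : 0 < c -> \forall x \near v, enorm (x - v) < c.
Proof.
move=> c0; have /cvgrPdistC_lt/(_ _ c0) := @enormB_continuous v v.
rewrite subrr enorm0; apply: filterS => x; rewrite subr0.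
exact: le_lt_trans (ler_norm _).
Qed.

Lemma nonexpansive_continuous (f : 'rV[R]_n -> 'rV[R]_n) :
  (forall x y, enorm (f x - f y) <= enorm (x - y)) -> continuous f.
Proof.
move=> fl v; apply: (cvgrPdistC_lt (F := nbhs v) f (f v)).2 => c c0.
have := near_enorm_lt v c0; apply: filterS => x; apply: le_lt_trans.
by apply: le_trans (norm_le_enorm _) _; exact: fl.
Qed.

Lemma bounded_of_sub_eball (A : set 'rV[R]_n) c :
  A `<=` eball c -> bounded_set A.
Proof.
move=> h; exists c; split; first exact: num_real.
by move=> M cM x /h /= xc; rewrite (le_trans (norm_le_enorm x)) ?(le_trans xc) ?ltW.
Qed.

Lemma compact_of_closed_bounded (A : set 'rV[R]_n) c :
  closed A -> A `<=` eball c -> compact A.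
Proof. by move=> cA /bounded_of_sub_eball bA; exact: bounded_closed_compact. Qed.

Lemma eball_compact c : compact (eball c : set 'rV[R]_n).
Proof.
by apply: (@compact_of_closed_bounded _ c) => //; exact/closed_sublevel/enorm_continuous.
Qed.

Lemma compact_sub_eball (A : set 'rV[R]_n) :
  compact A -> exists2 c, 0 <= c & A `<=` eball c.
Proof.
move=> cA; have [A0|/set0P/negP/negPn/eqP ->] := pselect (A !=set0); last first.
  by exists 0.
have [|p pA pmax] := @compact_EVT_max _ R (@enorm R n) A A0 cA.
  by apply: continuous_subspaceT; exact: enorm_continuous.
exists (enorm p); first exact: enorm_ge0.
by move=> x xA; apply: pmax; rewrite inE.
Qed.

End EuclideanNorm.

(** * Orthogonal projections and reflections *)

Section Reflection.
Variables (R : realType) (n : nat).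
Implicit Types (x y u v w : 'rV[R]_n) (H : {vspace 'rV[R]_n}).

Lemma mem_perpP H x : x \in perp H <-> {in H, forall v, dot x v = 0}.
Proof. by split=> [/mem_orthovP h v /h|h] //; apply/mem_orthovP. Qed.

Lemma perp_dot H x y : x \in perp H -> y \in H -> dot x y = 0.
Proof. by move=> /mem_perpP; exact. Qed.

(** Orthogonality to one more vector lowers the dimension by at most one. This
    bound gives the existence of the orthogonal decomposition. *)
Lemma leq_dim_perp_span (s : seq 'rV[R]_n) :
  (n - size s <= \dim (perp (span s)))%N.
Proof.
elim: s => [|u s IH] /=.
  by rewrite span_nil /perp orthov0 subn0 dimvf /dim /= mul1n.
have -> : perp (span (u :: s)) = (perp (span s) :&: perp <[u]>)%VS.
  apply/vspaceP => x; rewrite span_cons memv_cap.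
  apply/idP/andP => [/mem_perpP h|[/mem_perpP hs /mem_perpP hu]].
    split; apply/mem_perpP => v vs; apply: h.
      by rewrite -(add0r v) memv_add ?mem0v.
    by rewrite -(addr0 v) memv_add ?mem0v.
  by apply/mem_perpP => _ /memv_addP[a /hu ha [b /hs hb ->]]; rewrite dotDr ha hb addr0.
apply: leq_trans (leq_dim_orthov1 _ _ _).
by rewrite -subn1 -(addn1 (size s)) subnDA leq_sub2r.
Qed.

Lemma perp_cap H : (perp H :&: H = 0)%VS.
Proof.
apply/eqP; rewrite -subv0; apply/subvP => x; rewrite memv_cap => /andP[xp xH].
by rewrite memv0; apply/eqP/dot_eq0/(perp_dot xp xH).
Qed.

Lemma perp_add H : (perp H + H = fullv)%VS.
Proof.
apply/eqP; rewrite eqEdim subvf /=.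
rewrite dimv_disjoint_sum ?perp_cap // dimvf /dim /= mul1n.
have := leq_dim_perp_span (vbasis H).
by rewrite (span_basis (vbasisP H)) size_tuple leq_subLR addnC.
Qed.

Lemma mem_proj_perp H x : proj_perp H x \in perp H.
Proof. exact: memv_pi. Qed.

Lemma sub_proj_perp H x : x - proj_perp H x \in H.
Proof.
have {1}<- := daddv_pi_add (perp_cap H) (_ : x \in (perp H + H)%VS).
  by rewrite addrC addKr; exact: memv_pi.
by rewrite perp_add memvf.
Qed.

Lemma proj_perp_uniq H x y : y \in perp H -> x - y \in H -> proj_perp H x = y.
Proof.
move=> yp xy; apply/eqP; rewrite -subr_eq0 -memv0 -(perp_cap H) memv_cap.
rewrite rpredB ?mem_proj_perp //=.
have -> : proj_perp H x - y = (x - y) - (x - proj_perp H x).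
  by rewrite opprB [RHS]addrC addrA subrK.
by rewrite rpredB ?sub_proj_perp.
Qed.

Lemma reflectionD H x y : reflection H (x + y) = reflection H x + reflection H y.
Proof. by rewrite /reflection linearD scalerDr opprD addrACA. Qed.

Lemma reflectionZ H c x : reflection H (c *: x) = c *: reflection H x.
Proof.
rewrite /reflection [proj_perp H (c *: x)]linearZ /= scalerBr.
by rewrite !scalerA [2 * c]mulrC.
Qed.

Lemma reflectionN H x : reflection H (- x) = - reflection H x.
Proof. by rewrite -scaleN1r reflectionZ scaleN1r. Qed.

Lemma reflectionB H x y : reflection H (x - y) = reflection H x - reflection H y.
Proof. by rewrite reflectionD reflectionN. Qed.

Lemma reflection_perp H x : x \in perp H -> reflection H x = - x.
Proof.
move=> xp; rewrite /reflection (@proj_perp_uniq _ _ x) ?subrr ?mem0v //.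
by rewrite scaler_nat mulr2n opprD addrA subrr sub0r.
Qed.

Lemma reflection_sub H x : x \in H -> reflection H x = x.
Proof.
move=> xH; rewrite /reflection (@proj_perp_uniq _ _ 0) ?subr0 ?mem0v //.
by rewrite scaler0 subr0.
Qed.

Lemma reflection_decomp H x :
  reflection H x = (x - proj_perp H x) - proj_perp H x.
Proof. by rewrite /reflection scaler_nat mulr2n opprD addrA. Qed.

Lemma reflectionK H : involutive (reflection H).
Proof.
move=> x; rewrite {2}/reflection reflectionB reflectionZ.
rewrite (reflection_perp (mem_proj_perp H x)) scalerN opprK /reflection.
by rewrite subrK.
Qed.

Lemma dot_reflection2 H x y : dot (reflection H x) (reflection H y) = dot x y.
Proof.
have px := mem_proj_perp H x; have py := mem_proj_perp H y.
have hx := sub_proj_perp H x; have hy := sub_proj_perp H y.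
have e1 := perp_dot px hy; have e2 := perp_dot py hx.
move: e1 e2; rewrite [dot (proj_perp H y) _]dotC !reflection_decomp !dotBr !dotBl.
lra.
Qed.

Lemma dot_reflectionl H x y : dot (reflection H x) y = dot x (reflection H y).
Proof. by rewrite -{1}(reflectionK H y) dot_reflection2. Qed.

Lemma enorm_reflection H x : enorm (reflection H x) = enorm x.
Proof. by rewrite /enorm dot_reflection2. Qed.

Lemma sub_reflection H x : x - reflection H x = 2 *: proj_perp H x.
Proof. by rewrite /reflection subKr. Qed.

Lemma sub_reflection_perp H x : x - reflection H x \in perp H.
Proof. by rewrite sub_reflection rpredZ ?mem_proj_perp. Qed.

Lemma reflection_continuous H : continuous (reflection H).
Proof.
by apply: nonexpansive_continuous => x y; rewrite -reflectionB enorm_reflection.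
Qed.

End Reflection.
(** * Support functions and Hausdorff convergence *)

Section ConvexSets.
Variables (R : realType) (n : nat).
Implicit Types (x y u v : 'rV[R]_n) (A K L : set 'rV[R]_n) (c e t : R).

Lemma convex_setP A :
  convex_set (A : set (convex_lmodType 'rV[R]_n)) <->
  forall x y t, 0 <= t -> t <= 1 -> A x -> A y -> A (t *: x + (1 - t) *: y).
Proof.
split => [cA x y t t0 t1 Ax Ay|cA x y t /set_mem Ax /set_mem Ay].
  by have := cA x y (Itv01 t0 t1) (mem_set Ax) (mem_set Ay) => /set_mem.
by apply/mem_set/cA.
Qed.

Definition support K u : R := sup [set dot x u | x in K].

Lemma support_attained K u : convex_body K ->
  exists2 p, K p & support K u = dot p u /\ forall x, K x -> dot x u <= dot p u.
Proof.
move=> [K0 cK _].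
have [|p /set_mem Kp pmax] := @compact_EVT_max _ R (fun x => dot x u) K K0 cK.
  by apply: continuous_subspaceT; exact: dotl_continuous.
have {}pmax x : K x -> dot x u <= dot p u by move=> Kx; apply: pmax; rewrite inE.
exists p => //; split=> //; apply/eqP; rewrite eq_le; apply/andP; split.
  by apply: ge_sup => [|_ [x Kx <-]]; [exists (dot p u), p | exact: pmax].
by apply: ub_le_sup; [exists (dot p u) => _ [x Kx <-]; exact: pmax | exists p].
Qed.

Lemma dot_le_support K x u : convex_body K -> K x -> dot x u <= support K u.
Proof. by move=> bK Kx; have [p _ [-> h]] := support_attained u bK; exact: h. Qed.

Lemma support_le K u c :
  convex_body K -> (forall x, K x -> dot x u <= c) -> support K u <= c.
Proof. by move=> bK h; have [p Kp [-> _]] := support_attained u bK; exact: h. Qed.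

(** The nearest point [p] of [K] to [x] maximizes [dot _ (x - p)] over [K], and
    testing the hypothesis in that direction bounds [enorm (x - p)]. *)
Lemma separation K x e : convex_body K -> 0 <= e ->
  (forall u, dot x u <= support K u + e * enorm u) -> msum K (eball e) x.
Proof.
move=> bK e0 h; have [K0 cK /convex_setP vK] := bK.
have [|p /set_mem Kp pmin] := @compact_EVT_min _ R (fun y => enorm (y - x)) K K0 cK.
  by apply: continuous_subspaceT; exact: enormB_continuous.
have obtuse y : K y -> dot (y - p) (x - p) <= 0.
  move=> Ky; apply/ler_addgt0Pr => t' t'0; rewrite add0r.
  have d0 := dot_ge0 (y - p).
  (* a step length at which the quadratic term is at most the tolerance *)
  pose t := t' / (t' + dot (y - p) (y - p)).
  have D0 : 0 < t' + dot (y - p) (y - p) by lra.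
  have t0 : 0 < t by rewrite divr_gt0.
  have t1 : t <= 1 by rewrite ler_pdivrMr // mul1r lerDl.
  have := pmin _ (mem_set (vK y p t (ltW t0) t1 Ky Kp)).
  rewrite -(@ler_pXn2r R 2) // ?nnegrE ?enorm_ge0 // !sqr_enorm.
  have -> : t *: y + (1 - t) *: p - x = t *: (y - p) - (x - p).
    by apply/rowP => i; rewrite !mxE; ring.
  have -> : dot (p - x) (p - x) = dot (x - p) (x - p).
    by rewrite -sqr_enorm enormC sqr_enorm.
  have -> : dot (t *: (y - p) - (x - p)) (t *: (y - p) - (x - p)) =
      t * (t * dot (y - p) (y - p) - 2 * dot (y - p) (x - p)) + dot (x - p) (x - p).
    by move: (y - p) (x - p) => a b; rewrite !dotE [dot b a]dotC; ring.
  rewrite lerDr pmulr_rge0 // => h1.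
  have : t * dot (y - p) (y - p) <= t'.
    by rewrite mulrAC ler_pdivrMr // ler_pM2l // lerDr ltW.
  lra.
exists p => //; exists (x - p); last by rewrite addrC subrK.
rewrite /eball /=; have [-> //|xp0] := eqVneq (enorm (x - p)) 0.
have xp_gt0 : 0 < enorm (x - p) by rewrite lt_def xp0 enorm_ge0.
rewrite -(ler_pM2r xp_gt0) -expr2 sqr_enorm dotBl.
have := h (x - p).
have : support K (x - p) <= dot p (x - p).
  by apply: support_le => // y /obtuse; rewrite dotBl subr_le0.
lra.
Qed.

Lemma msum_eball_support K A e : convex_body K -> 0 <= e ->
  A `<=` msum K (eball e) <->
  forall x u, A x -> dot x u <= support K u + e * enorm u.
Proof.
move=> bK e0; split=> [h x u /h[a Ka [b /= be <-]]|h x Ax]; last first.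
  by apply: separation => // u; exact: h.
rewrite dotDl lerD ?dot_le_support //.
by rewrite (le_trans (dot_le_enorm _ _)) // ler_wpM2r ?enorm_ge0.
Qed.

Lemma body_sub_msum K L e : convex_body K -> convex_body L -> 0 <= e ->
  K `<=` msum L (eball e) <-> forall u, support K u <= support L u + e * enorm u.
Proof.
move=> bK bL e0; rewrite msum_eball_support //; split=> h.
  by move=> u; apply: support_le => // x Kx; exact: h.
by move=> x u Kx; apply: le_trans (h u); exact: dot_le_support.
Qed.

Lemma body_norm_le K : convex_body K ->
  exists2 c, 0 <= c & K `<=` eball c.
Proof. by move=> [_ cK _]; exact: compact_sub_eball. Qed.

Lemma support_lipschitz K c u v : convex_body K -> K `<=` eball c ->
  support K u - support K v <= c * enorm (u - v).
Proof.
move=> bK Kc; rewrite lerBlDl; apply: support_le => // x Kx.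
have -> : dot x u = dot x v + dot x (u - v) by rewrite dotBr addrC subrK.
rewrite lerD ?dot_le_support // (le_trans (dot_le_enorm _ _)) //.
by rewrite ler_wpM2r ?enorm_ge0 //; exact: Kc.
Qed.

Lemma support_le_enorm K c u : convex_body K -> K `<=` eball c ->
  `|support K u| <= c * enorm u.
Proof.
move=> bK Kc; have [p Kp [-> _]] := support_attained u bK.
rewrite ler_norml -lerNl -dotNl; apply/andP; split;
  apply: le_trans (dot_le_enorm _ _) _; rewrite ?enormN ler_wpM2r ?enorm_ge0 //;
  exact: Kc.
Qed.

Lemma supportZ K c u : convex_body K -> 0 <= c ->
  support K (c *: u) = c * support K u.
Proof.
move=> bK c0; apply/eqP; rewrite eq_le; apply/andP; split.
  by apply: support_le => // x Kx; rewrite dotZr ler_wpM2l ?dot_le_support.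
have [p Kp [-> _]] := support_attained u bK.
by rewrite -dotZr dot_le_support.
Qed.

(** By [body_sub_msum] the Hausdorff distance of two bodies is the largest
    difference of their support functions on the unit sphere. *)
Lemma converges_support (K_ : nat -> set 'rV[R]_n) L :
  (forall m, convex_body (K_ m)) -> convex_body L ->
  converges_to K_ L <->
  forall e, 0 < e -> exists N, forall m, (N <= m)%N ->
    forall u, `|support (K_ m) u - support L u| <= e * enorm u.
Proof.
move=> bK bL.
pose near_set m := [set r : R | [/\ 0 <= r,
  K_ m `<=` msum L (eball r) & L `<=` msum (K_ m) (eball r)]].
have near_ge0 m : lbound (near_set m) 0 by move=> r [].
have near_nonempty m : near_set m !=set0.
  have [c c0 Kc] := body_norm_le (bK m); have [d d0 Ld] := body_norm_le bL.
  exists (c + d); split; first exact: addr_ge0.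
    apply/body_sub_msum; rewrite ?addr_ge0 // => u.
    have := support_le_enorm u (bK m) Kc; have := support_le_enorm u bL Ld.
    by rewrite !ler_norml => /andP[? ?] /andP[? ?]; lra.
  apply/body_sub_msum; rewrite ?addr_ge0 // => u.
  have := support_le_enorm u (bK m) Kc; have := support_le_enorm u bL Ld.
  by rewrite !ler_norml => /andP[? ?] /andP[? ?]; lra.
have near_setP m r : 0 <= r ->
    near_set m r <-> forall u, `|support (K_ m) u - support L u| <= r * enorm u.
  move=> r0; split=> [[_ /body_sub_msum h1 /body_sub_msum h2] u|h].
    have := h1 (bK m) bL r0 u; have := h2 bL (bK m) r0 u.
    by rewrite ler_norml => ? ?; apply/andP; split; lra.
  split=> //; apply/body_sub_msum => // u; have := h u;
    by rewrite ler_norml => /andP[? ?]; lra.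
have dist_ge0 m : 0 <= hausdorff_distance (K_ m) L.
  exact: (lb_le_inf (near_nonempty m) (@near_ge0 m)).
split=> [/cvgrPdist_lt cv e e0|h].
  have [N _ hN] := cv e e0; exists N => m Nm u.
  have /= := hN m Nm; rewrite sub0r normrN ger0_norm // => /(inf_lt (near_nonempty m)).
  move=> [r rm /ltW re]; have r0 := near_ge0 m r rm.
  move/(near_setP m r r0): rm => /(_ u) /le_trans; apply.
  by rewrite ler_wpM2r ?enorm_ge0.
apply/cvgrPdist_le => e e0; have [N hN] := h e e0; exists N => // m Nm /=.
rewrite sub0r normrN ger0_norm //; apply: ge_inf; first by exists 0; exact: near_ge0.
by apply/(near_setP m e (ltW e0)) => u; exact: hN.
Qed.

(** Completeness of the space of convex bodies: the limit consists of the
    points [x] lying in every known outer bound [K_ N + e B]; near any point of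
    a late [K_ m] there is such a point, as a cluster point of nearby points of
    the later bodies. *)
Lemma body_complete (K_ : nat -> set 'rV[R]_n) :
  (forall m, convex_body (K_ m)) ->
  (forall e, 0 < e -> exists N, forall i j, (N <= i)%N -> (N <= j)%N ->
    forall u, support (K_ i) u <= support (K_ j) u + e * enorm u) ->
  exists2 L, convex_body L & converges_to K_ L.
Proof.
move=> bK cauchy.
pose outer N e := [set x | forall u, dot x u <= support (K_ N) u + e * enorm u].
pose good N e := 0 < e /\ forall i, (N <= i)%N -> K_ i `<=` outer N e.
have closed_outer N e : closed (outer N e).
  have -> : outer N e = \bigcap_u [set x | dot x u <= support (K_ N) u + e * enorm u].
    by apply/seteqP; split=> x h u; [move=> _; exact: h | exact: (h u)].
  by apply: closed_bigI => u _; apply/closed_sublevel/dotl_continuous.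
have ex_good e : 0 < e -> exists2 N, good N e &
    forall i j, (N <= i)%N -> (N <= j)%N ->
      forall u, support (K_ i) u <= support (K_ j) u + e * enorm u.
  move=> e0; have [N hN] := cauchy e e0; exists N => //; split=> // i Ni x Kx u.
  by apply: le_trans (hN i N Ni (leqnn N) u); exact: dot_le_support.
pose L := [set x | forall N e, good N e -> outer N e x].
have L_sub N e : good N e -> L `<=` msum (K_ N) (eball e).
  by move=> [e0 gN] x Lx; apply: separation => //; [exact: ltW | apply: Lx].
have sub_L e : 0 < e -> exists N, forall m, (N <= m)%N -> K_ m `<=` msum L (eball e).
  move=> e0; have [N gN hN] := ex_good e e0; exists N => m Nm x Kx.
  have pick j : exists y, (N <= j)%N -> K_ j y /\ enorm (y - x) <= e.
    have [Nj|_] := leqP N j; last by exists x.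
    have /body_sub_msum/(_ x Kx)[//|||y Ky [b be <-]] := hN m j Nm Nj; rewrite ?ltW //.
    by exists y => _; split=> //; rewrite opprD addrA subrr sub0r enormN.
  have [y yP] := choice pick.
  have [d d0 Kd] := body_norm_le (bK m).
  have : (eball (d + e) : set 'rV[R]_n) `&` cluster (y @ \oo) !=set0.
    apply: eball_compact; exists N => // j /yP[_ yx].
    rewrite /preimage /eball /= -(subrK x (y j)) (le_trans (ler_enormD _ _)) //.
    by rewrite addrC lerD //; exact: Kd.
  move=> [z [_ zy]].
  have z_in (A : set 'rV[R]_n) M : closed A -> (forall j, (M <= j)%N -> A (y j)) -> A z.
    by move=> cA hA; apply: cA => B Bz; apply: zy => //; exists M.
  exists z.
    move=> N' e' [e'0 gN']; apply: (z_in _ (maxn N N')); first exact: closed_outer.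
    by move=> j; rewrite geq_max => /andP[/yP[Ky _] N'j]; exact: (gN' j).
  exists (x - z); last by rewrite addrC subrK.
  rewrite /eball /= enormC.
  apply: (z_in [set z | enorm (z - x) <= e] N); last by move=> j /yP[].
  exact/closed_sublevel/enormB_continuous.
have [N1 gN1 _] := ex_good 1 ltr01.
have bL : convex_body L.
  split.
  - have [N hN] := sub_L 1 ltr01; have [[x Kx] _ _] := bK N.
    by have [y Ly _] := hN N (leqnn N) x Kx; exists y.
  - have [d d0 Kd] := body_norm_le (bK N1).
    apply: (@compact_of_closed_bounded _ _ _ (d + 1)) => [|x /(L_sub N1 1 gN1)].
      have -> : L = \bigcap_(p in [set p | good p.1 p.2]) outer p.1 p.2.
        apply/seteqP; split=> x h; first by move=> [N e] /=; exact: h.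
        by move=> N e g; exact: (h (N, e)).
      by apply: closed_bigI => p _.
    move=> [a /Kd ad [b b1 <-]]; rewrite /eball /= (le_trans (ler_enormD _ _)) //.
    by apply: lerD.
  - apply/convex_setP => x y t t0 t1 Lx Ly N e g u.
    rewrite dotDl !dotZl.
    have -> : support (K_ N) u + e * enorm u = t * (support (K_ N) u + e * enorm u)
      + (1 - t) * (support (K_ N) u + e * enorm u) by ring.
    by rewrite lerD // ler_wpM2l ?subr_ge0 //; [exact: Lx | exact: Ly].
exists L => //; apply/converges_support => // e e0.
have [N gN hN] := ex_good (e / 2) (divr_gt0 e0 (ltr0n _ 2)).
have [M hM] := sub_L e e0.
exists (maxn N M) => m; rewrite geq_max => /andP[Nm Mm] u.
have /body_sub_msum h1 := hM m Mm; have {}h1 := h1 (bK m) bL (ltW e0) u.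
have /body_sub_msum h2 := L_sub _ _ gN.
have {}h2 := h2 bL (bK N) (ltW (divr_gt0 e0 (ltr0n _ 2))) u.
have h3 := hN N m (leqnn N) Nm u.
by rewrite ler_norml; apply/andP; split; lra.
Qed.

End ConvexSets.
(** * Averaging operators *)

Section Averages.
Variables (R : realType) (n : nat).
Implicit Types (x y u v w : 'rV[R]_n) (A K L : set 'rV[R]_n) (c d e t : R).
Implicit Types (H : {vspace 'rV[R]_n}) (Hs : nat -> {vspace 'rV[R]_n}).
Implicit Types (f g : 'rV[R]_n -> R) (D E : set_operation R n).

Definition average H f u : R := (f u + f (reflection H u)) / 2.

Fixpoint averages Hs k m f : 'rV[R]_n -> R :=
  if m is m'.+1 then average (Hs (k + m')%N) (averages Hs k m' f) else f.

(** The symmetral after [m] steps. Unlike [successive] it allows [m = 0], so that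
    it runs in parallel with [averages]. *)
Fixpoint process D Hs k m K : set 'rV[R]_n :=
  if m is m'.+1 then D (Hs (k + m')%N) (process D Hs k m' K) else K.

Lemma successiveE D Hs k K j : successive D Hs k K j = process D Hs k j.+1 K.
Proof. by elim: j => [|j /= ->] /=; rewrite ?addn0. Qed.

Lemma averages_add Hs k i j f :
  averages Hs k (i + j) f = averages Hs (k + i) j (averages Hs k i f).
Proof. by elim: j => [|j IH]; rewrite ?addn0 // addnS /= IH addnA. Qed.

(** Reflections preserve every sphere, so averaging is monotone, and commutes with
    constants, on each sphere separately. *)
Lemma averages_le Hs k m f g e r :
  (forall u, enorm u = r -> f u <= g u + e) ->
  forall u, enorm u = r -> averages Hs k m f u <= averages Hs k m g u + e.
Proof.
move=> h; elim: m => [|m IH] u ur /=; first exact: h.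
have := IH u ur; have := IH (reflection (Hs (k + m)%N) u).
by rewrite enorm_reflection => /(_ ur); rewrite /average; lra.
Qed.

Lemma averages_comb Hs k m f g c d u :
  averages Hs k m (fun u => c * f u + d * g u) u =
  c * averages Hs k m f u + d * averages Hs k m g u.
Proof. by elim: m u => [|m IH] u //=; rewrite /average !IH; lra. Qed.

Lemma averages_cst Hs k m c u : averages Hs k m (fun=> c) u = c.
Proof. by elim: m u => [|m IH] u //=; rewrite /average !IH; lra. Qed.

Lemma averages_lipschitz Hs k m f c :
  (forall u v, f u - f v <= c * enorm (u - v)) ->
  forall u v, averages Hs k m f u - averages Hs k m f v <= c * enorm (u - v).
Proof.
move=> h; elim: m => [|m IH] u v /=; first exact: h.
have := IH u v.
have := IH (reflection (Hs (k + m)%N) u) (reflection (Hs (k + m)%N) v).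
by rewrite -reflectionB enorm_reflection /average; lra.
Qed.

Lemma compact_net A d : compact A -> 0 < d ->
  exists2 s : seq 'rV[R]_n, (forall u, u \in s -> A u) &
    forall v, A v -> exists2 u, u \in s & enorm (v - u) <= d.
Proof.
move=> cA d0; move: cA; rewrite compact_cover.
move=> /(_ _ A (fun u => [set x | enorm (x - u) < d])).
case=> [u _||F FA cov].
- apply: (@open_comp _ _ (fun x => enorm (x - u)) [set r | r < d]); last exact: open_lt.
  by move=> x _; exact: enormB_continuous.
- by move=> v Av; exists v => //=; rewrite subrr enorm0.
exists (finmap.enum_fset F) => [u /FA /set_mem //|v /cov[u uF /ltW uv]].
by exists u.
Qed.

(** A net of the sphere is mapped to a net by every reflection, so the averages
    of a nonnegative function over a fixed net cannot all be small unless the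
    function itself is. The sum over the net thus serves as a substitute for an
    integral over the sphere against the invariant measure. *)
Lemma le_sum_averages Hs k m f (s : seq 'rV[R]_n) c d :
  (forall u, enorm u = 1 -> 0 <= f u) -> 0 <= c ->
  (forall u v, f u - f v <= c * enorm (u - v)) ->
  (forall u, u \in s -> enorm u = 1) ->
  (forall v, enorm v = 1 -> exists2 u, u \in s & enorm (v - u) <= d) ->
  forall v, enorm v = 1 -> f v <= \sum_(u <- s) averages Hs k m f u + c * d.
Proof.
move=> f0 c0 fL; elim: m s => [|m IH] s s1 net v v1 /=.
  have [u us vu] := net v v1.
  have : f u <= \sum_(u <- s) f u.
    rewrite (big_rem u) //= lerDl big_seq sumr_ge0 // => w /mem_rem ws.
    exact/f0/s1.
  have := fL v u; have := ler_wpM2l c0 vu; lra.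
pose r := reflection (Hs (k + m)%N).
have h1 := IH s s1 net v v1.
have h2 : f v <= \sum_(u <- map r s) averages Hs k m f u + c * d.
  apply: IH => // [_ /mapP[u us ->]|w w1].
    by rewrite enorm_reflection; exact: s1.
  have [|u us wu] := net (r w); first by rewrite enorm_reflection.
  exists (r u); first exact: map_f.
  by rewrite -(reflectionK (Hs (k + m)%N) w) -reflectionB enorm_reflection.
rewrite big_map in h2.
rewrite /average -mulr_suml big_split /=; lra.
Qed.

Definition uniformly_cauchy (F : nat -> 'rV[R]_n -> R) : Prop :=
  forall e, 0 < e -> exists N, forall i j, (N <= i)%N -> (N <= j)%N ->
    forall u, enorm u = 1 -> F i u <= F j u + e.

Lemma support_le_sphere K L e : convex_body K -> convex_body L ->
  (forall u, enorm u = 1 -> support K u <= support L u + e) ->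
  forall u, support K u <= support L u + e * enorm u.
Proof.
move=> bK bL h u; have [->|u0] := eqVneq u 0.
  by rewrite -(scale0r 0) !supportZ // scale0r enorm0 !mul0r mulr0 addr0.
have nu0 : 0 < enorm u.
  by rewrite lt_def enorm_ge0 andbT; apply: contraNneq u0 => /enorm_eq0 ->.
have := h _ (unit_vector u0).
rewrite !supportZ ?invr_ge0 ?enorm_ge0 // -(ler_pM2l nu0) mulrDr !mulrA.
by rewrite !divff ?gt_eqF // !mul1r [_ * e]mulrC.
Qed.

Lemma symmetric_wrtP H A :
  (forall x, A x -> A (reflection H x)) -> symmetric_wrt H A.
Proof.
move=> h; apply/seteqP; split=> [_ [x Ax <-]|x Ax]; first exact: h.
by exists (reflection H x); [exact: h | exact: reflectionK].
Qed.

Lemma symmetric_wrt_mem H A x : symmetric_wrt H A -> A x -> A (reflection H x).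
Proof. by move=> S Ax; rewrite -S; exists x. Qed.

Lemma eball_body c : 0 <= c -> convex_body (eball c : set 'rV[R]_n).
Proof.
move=> c0; split; first by exists 0; rewrite /eball /= enorm0.
  exact: eball_compact.
apply/convex_setP => x y t t0 t1 xc yc; rewrite /eball /=.
rewrite (le_trans (ler_enormD _ _)) // !enormZ !ger0_norm ?subr_ge0 //.
have := ler_wpM2l t0 xc; have := ler_wpM2l (_ : 0 <= 1 - t) yc.
by rewrite subr_ge0 => /(_ t1); lra.
Qed.

Lemma eball_symmetric H c : symmetric_wrt H (eball c).
Proof. by apply: symmetric_wrtP => x; rewrite /eball /= enorm_reflection. Qed.

End Averages.
(** * Bounds valid for every symmetrization of the family *)

Section FamilyF.
Variables (R : realType) (n : nat).
Implicit Types (x y u v w p q : 'rV[R]_n) (A K L : set 'rV[R]_n) (c d e t : R).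
Implicit Types (H : {vspace 'rV[R]_n}) (Hs : nat -> {vspace 'rV[R]_n}).
Implicit Types (f g : 'rV[R]_n -> R) (D E : set_operation R n).

Lemma image_body (f : 'rV[R]_n -> 'rV[R]_n) K : continuous f ->
  (forall x y t, f (t *: x + (1 - t) *: y) = t *: f x + (1 - t) *: f y) ->
  convex_body K -> convex_body (f @` K).
Proof.
move=> cf af [[x Kx] cK /convex_setP vK]; split; first by exists (f x), x.
  by apply: continuous_compact => //; exact: continuous_subspaceT.
apply/convex_setP => _ _ t t0 t1 [a Ka <-] [b Kb <-]; rewrite -af.
by exists (t *: a + (1 - t) *: b) => //; exact: vK.
Qed.

Lemma translate_body K x : convex_body K -> convex_body [set y + x | y in K].
Proof.
apply: image_body => [|a b t]; last by apply/rowP => i; rewrite !mxE; ring.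
by apply: nonexpansive_continuous => a b; rewrite opprD addrACA subrr addr0.
Qed.

Lemma segment_continuous x y : continuous (fun t : R => t *: x + (1 - t) *: y).
Proof.
have -> : (fun t : R => t *: x + (1 - t) *: y) = (fun t : R => t *: (x - y) + y).
  by apply/funext => t; apply/rowP => i; rewrite !mxE; ring.
move=> t; apply: (@cvgD _ _ _ (nbhs t)); last exact: cvg_cst.
exact: (@scalel_continuous _ _ (x - y) t).
Qed.

Lemma segment_body x y :
  convex_body [set t *: x + (1 - t) *: y | t in `[0, 1]%classic].
Proof.
split; first by exists (1 *: x + (1 - 1) *: y), 1; rewrite //= in_itv /= ler01 lexx.
  apply: continuous_compact; last exact: segment_compact.
  exact/continuous_subspaceT/segment_continuous.
apply/convex_setP => _ _ s s0 s1 [a + <-] [b + <-].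
rewrite /= !in_itv /= => /andP[a0 a1] /andP[b0 b1].
exists (s * a + (1 - s) * b); last by apply/rowP => i; rewrite !mxE; ring.
rewrite /= in_itv /=; apply/andP; split.
  by rewrite addr_ge0 // mulr_ge0 // subr_ge0.
have := ler_wpM2l s0 a1; have := ler_wpM2l (_ : 0 <= 1 - s) b1.
by rewrite subr_ge0 => /(_ s1); lra.
Qed.

(** The halfspaces [dot y u <= c] and [dot y (R u) <= c], with [c] the average
    of the support function of [K] at [u] and [R u], cut out an H-symmetric body
    that contains a translate of [K] by a vector of [perp H]. *)
Lemma family_support D H K u : family_F D -> proper_subspace H -> convex_body K ->
  support (D H K) u <= average H (support K) u.
Proof.
move=> [symD famD] pH bK; have [mono trans _] := famD H pH.
have [bDK _] := symD H pH K bK.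
have [rho rho0 Krho] := body_norm_le bK.
set c := average H (support K) u.
have [x xH xu] : exists2 x, x \in perp H &
    dot x u = (support K u - support K (reflection H u)) / 2.
  have [p0|p0] := eqVneq (proj_perp H u) 0.
    exists 0; first exact: mem0v.
    by rewrite /reflection p0 scaler0 subr0 subrr mul0r dot0l.
  set p := proj_perp H u in p0 *.
  have pp : dot p p != 0 by apply: contraNneq p0 => /dot_eq0 ->.
  exists (((support K u - support K (reflection H u)) / 2 / dot p p) *: p).
    by rewrite rpredZ ?mem_proj_perp.
  have -> : dot (((support K u - support K (reflection H u)) / 2 / dot p p) *: p) u
     = (support K u - support K (reflection H u)) / 2 / dot p p * dot p u.
    by rewrite dotZl.
  have -> : dot p u = dot p p.
    rewrite -{1}(subrK p u) dotDr (perp_dot (mem_proj_perp H u)) ?add0r //.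
    exact: sub_proj_perp.
  by rewrite divfK.
have Rx : dot x (reflection H u) = - dot x u.
  by rewrite -dot_reflectionl (reflection_perp xH) dotNl.
pose L := [set y | [/\ enorm y <= rho + enorm x, dot y u <= c &
  dot y (reflection H u) <= c]].
have symL : symmetric_wrt H L.
  apply: symmetric_wrtP => y [y1 y2 y3]; split; first by rewrite enorm_reflection.
    by rewrite dot_reflectionl.
  by rewrite dot_reflection2.
have KL : K `<=` [set y + x | y in L].
  move=> k Kk; exists (k - x); last by rewrite subrK.
  split; first by rewrite (le_trans (ler_enormB _ _)) // lerD2r; exact: Krho.
    have := dot_le_support u bK Kk; rewrite dotBl xu /c /average; lra.
  have := dot_le_support (reflection H u) bK Kk.
  rewrite dotBl Rx xu /c /average; lra.
have bL : convex_body L.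
  have [[k Kk] _ _] := bK; have [y Ly _] := KL k Kk.
  split; first by exists y.
    apply: (@compact_of_closed_bounded _ _ _ (rho + enorm x)); last by move=> ? [].
    have -> : L = [set y | enorm y <= rho + enorm x] `&`
      ([set y | dot y u <= c] `&` [set y | dot y (reflection H u) <= c]).
      by apply/seteqP; split=> [? []|? [? []]].
    apply: closedI; first exact/closed_sublevel/enorm_continuous.
    by apply: closedI; exact/closed_sublevel/dotl_continuous.
  apply/convex_setP => a b t t0 t1 [a1 a2 a3] [b1 b2 b3].
  have t1' : 0 <= 1 - t by rewrite subr_ge0.
  split.
  - have r0 : 0 <= rho + enorm x by rewrite addr_ge0 ?enorm_ge0.
    have [_ _ /convex_setP vB] := eball_body n r0.
    exact: vB.
  - by rewrite dotDl !dotZl; have := ler_wpM2l t0 a2; have := ler_wpM2l t1' b2; lra.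
  - by rewrite dotDl !dotZl; have := ler_wpM2l t0 a3; have := ler_wpM2l t1' b3; lra.
apply: support_le => // z /(mono _ _ bK (translate_body x bL) KL).
by rewrite trans // => -[].
Qed.

(** The segment from [p] to [q] is a translate, along [perp H], of the
    H-symmetric segment from [(p + R q) / 2] to its mirror image. *)
Lemma family_segment D H K p q : family_F D -> proper_subspace H ->
  convex_body K -> K p -> K q -> p - q \in perp H ->
  D H K (2^-1 *: (p + reflection H q)).
Proof.
move=> [_ famD] pH bK Kp Kq pq; have [mono trans _] := famD H pH.
set z := 2^-1 *: _; set x := 2^-1 *: (p - reflection H q).
have Rpq : reflection H p - reflection H q = q - p.
  by rewrite -reflectionB reflection_perp // opprB.
have zx : z + x = p by apply/rowP => i; rewrite !mxE; field.
have Rzx : reflection H z + x = q.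
  rewrite /z reflectionZ reflectionD reflectionK.
  have -> : reflection H p = q - p + reflection H q by rewrite -Rpq subrK.
  by apply/rowP => i; rewrite !mxE; field.
have xp : x \in perp H.
  rewrite rpredZ //; have -> : p - reflection H q = (p - q) + (q - reflection H q).
    by rewrite addrA subrK.
  by rewrite rpredD ?sub_reflection_perp.
pose L := [set t *: z + (1 - t) *: reflection H z | t in `[0, 1]%classic].
have bL : convex_body L by exact: segment_body.
have symL : symmetric_wrt H L.
  apply: symmetric_wrtP => _ [t + <-]; rewrite /= in_itv /= => /andP[t0 t1].
  exists (1 - t); first by rewrite /= in_itv /= subr_ge0 t1 lerBlDr lerDl.
  by rewrite reflectionD !reflectionZ reflectionK subKr addrC.
have LK : [set y + x | y in L] `<=` K.
  move=> _ [_ [t + <-] <-]; rewrite /= in_itv /= => /andP[t0 t1].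
  have [_ _ /convex_setP vK] := bK.
  have -> : t *: z + (1 - t) *: reflection H z + x =
      t *: (z + x) + (1 - t) *: (reflection H z + x).
    by apply/rowP => i; rewrite !mxE; ring.
  by rewrite zx Rzx; exact: vK.
have := mono _ _ (translate_body x bL) bK LK; rewrite trans //; apply.
by exists 1; rewrite ?subrr ?scale0r ?addr0 ?scale1r //= in_itv /= ler01 lexx.
Qed.

Lemma process_body D Hs k m K : family_F D -> (forall m, proper_subspace (Hs m)) ->
  convex_body K -> convex_body (process D Hs k m K).
Proof.
move=> [sD _] pH bK; elim: m => [|m IH] //=.
by case: (sD _ (pH (k + m)%N) _ IH).
Qed.

Lemma process_sub_eball D Hs k m K c : family_F D ->
  (forall m, proper_subspace (Hs m)) -> convex_body K -> 0 <= c ->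
  K `<=` eball c -> process D Hs k m K `<=` eball c.
Proof.
move=> fD pH bK c0 Kc; elim: m => [|m IH] //=.
have [_ /(_ _ (pH (k + m)%N))[mono _ inv]] := fD.
have bc := eball_body n c0.
rewrite -[eball c](inv _ bc (eball_symmetric _ _)).
by apply: mono => //; exact: process_body.
Qed.

Lemma support_process_le D Hs k m j K u : family_F D ->
  (forall m, proper_subspace (Hs m)) -> convex_body K ->
  support (process D Hs k (m + j) K) u <=
  averages Hs (k + m) j (support (process D Hs k m K)) u.
Proof.
move=> fD pH bK; elim: j u => [|j IH] u; first by rewrite addn0.
rewrite addnS /=; apply: le_trans (family_support _ fD (pH _) _) _.
  exact: process_body.
by rewrite addnA /average; have := IH u; have := IH (reflection (Hs (k + m + j)%N) u); lra.
Qed.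

End FamilyF.
(** * Convergence of averages implies stability *)

Section MinkowskiDomination.
Variables (R : realType) (n : nat).
Implicit Types (x y u v w p q : 'rV[R]_n) (A K L : set 'rV[R]_n) (c d e t : R).
Implicit Types (H : {vspace 'rV[R]_n}) (Hs : nat -> {vspace 'rV[R]_n}).
Implicit Types (f g : 'rV[R]_n -> R) (D E : set_operation R n).

(** Let [a m j] be the averages, over the [j] steps from time [m] on, of the
    support function [f m] of the [m]-th body. Up to [eps] the functions [f m] are
    eventually bounded by [G = a m0 J0], for [m0] and [J0] large. On a finite net
    the averages of [G] and those of [f m] both have limits close to the same
    value, since the limit of [a m j] in [j] is nonincreasing in [m]. So the
    averages of the nonnegative function [G + eps - f m] are small on the net,
    hence [f m] is close to [G]. *)
Lemma cauchy_process D Hs k K : family_F D -> (forall m, proper_subspace (Hs m)) ->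
  (forall k K, convex_body K ->
     uniformly_cauchy (fun m => averages Hs k m (support K))) ->
  convex_body K -> uniformly_cauchy (fun m => support (process D Hs k m K)).
Proof.
move=> fD pH cauchy bK.
pose f m := support (process D Hs k m K).
have bP m : convex_body (process D Hs k m K) by exact: process_body.
pose a m j := averages Hs (k + m) j (f m).
have acauchy m : uniformly_cauchy (a m) by exact: cauchy.
have f_le_a m j u : f (m + j)%N u <= a m j u by exact: support_process_le.
have a_le m i j u : a (m + i)%N j u <= a m (i + j)%N u.
  rewrite /a averages_add addnA -[leRHS]addr0.
  apply: (@averages_le _ _ _ _ _ _ _ 0 (enorm u)) => //.
  by move=> v _; rewrite addr0; exact: f_le_a.
have [rho rho0 Krho] := body_norm_le bK.
have f_lip m u v : f m u - f m v <= rho * enorm (u - v).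
  by apply: support_lipschitz => //; exact: process_sub_eball.
have f_ge m u : enorm u = 1 -> - rho <= f m u.
  move=> u1; have Pc : process D Hs k m K `<=` eball rho by exact: process_sub_eball.
  by have := support_le_enorm u (bP m) Pc; rewrite u1 mulr1 ler_norml => /andP[].
(* the infimum over [m] of the limits over [j] of [a m j u] *)
pose S u := [set c | exists m J, forall j, (J <= j)%N -> a m j u <= c].
pose I u := inf (S u).
have S_lb u : enorm u = 1 -> lbound (S u) (- rho).
  move=> u1 c [m [J /(_ J (leqnn J))]]; apply: le_trans.
  by apply: le_trans (f_le_a m J u); exact: f_ge.
have S_ne u : enorm u = 1 -> S u !=set0.
  move=> u1; have [J hJ] := acauchy 0%N 1 ltr01.
  by exists (a 0%N J u + 1), 0%N, J => j Jj; exact: hJ.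
have I_le u e : enorm u = 1 -> 0 < e ->
    exists m0, forall m, (m0 <= m)%N -> exists J, forall j, (J <= j)%N -> a m j u <= I u + e.
  move=> u1 e0; have [|c [m0 [J hJ]] cI] := inf_adherent e0 (conj (S_ne u u1) _).
    by exists (- rho); exact: S_lb.
  exists m0 => m m0m; exists J => j Jj; apply: le_trans (ltW cI).
  rewrite -(subnKC m0m); apply: le_trans (a_le _ _ _ _) (hJ _ _).
  by rewrite (leq_trans Jj) ?leq_addl.
have I_ge u e m : enorm u = 1 -> 0 < e ->
    exists J, forall j, (J <= j)%N -> I u - e <= a m j u.
  move=> u1 e0; have [J hJ] := acauchy m e e0; exists J => j Jj.
  rewrite lerBlDr; apply: ge_inf; first by exists (- rho); exact: S_lb.
  by exists m, J => i Ji; exact: hJ.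
have I_near (s : seq 'rV[R]_n) e : (forall u, u \in s -> enorm u = 1) -> 0 < e ->
    exists m0, forall m, (m0 <= m)%N -> exists J, forall j, (J <= j)%N ->
      forall u, u \in s -> I u - e <= a m j u <= I u + e.
  move=> + e0; elim: s => [|v s IH] s1; first by exists 0%N => m _; exists 0%N.
  have [u us|m1 h1] := IH; first by apply: s1; rewrite inE us orbT.
  have v1 : enorm v = 1 by apply: s1; rewrite mem_head.
  have [m2 h2] := I_le v e v1 e0; exists (maxn m1 m2) => m.
  rewrite geq_max => /andP[/h1[J1 hJ1] /h2[J2 hJ2]].
  have [J3 hJ3] := I_ge v e m v1 e0; exists (maxn J1 (maxn J2 J3)) => j.
  rewrite !geq_max => /andP[/hJ1 ? /andP[/hJ2 ? /hJ3 ?]] u.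
  by rewrite inE => /orP[/eqP ->|]; [apply/andP|auto].
move=> eta eta0.
(* mesh of the net and tolerance on it, for a total error of at most [eta] *)
pose d := eta / 4 / (rho + 1).
have d0 : 0 < d by rewrite !divr_gt0 // ltr_pwDr.
have cS : compact [set u : 'rV[R]_n | enorm u = 1].
  apply: (@compact_of_closed_bounded _ _ _ 1) => [|u /= u1]; last by rewrite /eball /= u1.
  apply: (@preimage_closed _ _ (@enorm R n) [set 1]); last exact: closed_eq.
  by move=> u _; exact: enorm_continuous.
have [s s1 net] := compact_net cS d0.
pose e := eta / (2 * (5 * (size s)%:R + 1)).
have D0 : 0 < 5 * (size s)%:R + 1 :> R by rewrite ltr_wpDl // mulr_ge0 // ler0n.
have e0 : 0 < e by rewrite divr_gt0 // mulr_gt0.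
have [m0 near] := I_near s e s1 e0.
have [J0 hJ0] := acauchy m0 e e0.
pose G := a m0 J0.
have G_lip u v : G u - G v <= rho * enorm (u - v).
  by apply: averages_lipschitz => x y; exact: f_lip.
suff main m : (m0 + J0 <= m)%N -> forall u, enorm u = 1 ->
    f m u <= G u + e /\ G u + e <= f m u + (5 * (size s)%:R * e + 2 * rho * d).
  exists (m0 + J0)%N => i j hi hj u u1.
  have [h1 _] := main i hi u u1; have [_ h2] := main j hj u u1.
  have e1 : e * (5 * (size s)%:R + 1) = eta / 2.
    by rewrite /e; field; rewrite gt_eqF.
  have d1 : d * (rho + 1) = eta / 4 by rewrite /d divfK // gt_eqF // ltr_pwDr.
  rewrite -/(f i u) -/(f j u); lra.
move=> hm; have m0m : (m0 <= m)%N by rewrite (leq_trans _ hm) ?leq_addr.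
have hm' : (J0 <= m - m0)%N by rewrite -(leq_add2l m0) subnKC.
have G_ge u : enorm u = 1 -> f m u <= G u + e.
  move=> u1; have := f_le_a m0 (m - m0)%N u; rewrite subnKC // => /le_trans; apply.
  exact: hJ0.
have [J hJ] := near m m0m; have [J' hJ'] := near m0 (leqnn m0).
pose j := maxn J J'.
pose g u := 1 * G u + 1 * (e - f m u).
move=> u u1; split; first exact: G_ge.
have -> : G u + e = f m u + g u by rewrite /g !mul1r; ring.
rewrite lerD2l.
have gL v w : g v - g w <= 2 * rho * enorm (v - w).
  by have := G_lip v w; have := f_lip m w v; rewrite [enorm (w - v)]enormC /g; lra.
have := @le_sum_averages _ _ Hs (k + m)%N j g s (2 * rho) d.
move=> /(_ _ _ gL s1 net u u1) => /(_ _ _)/le_trans; apply.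
- by move=> v v1; rewrite /g !mul1r; have := G_ge v v1; lra.
- by rewrite mulr_ge0.
rewrite lerD2r.
have gj v : v \in s -> averages Hs (k + m) j g v <= 5 * e.
  move=> vs; have v1 := s1 v vs.
  rewrite averages_comb !mul1r.
  have -> : averages Hs (k + m) j (fun u => e - f m u) v = e - a m j v.
    have -> : (fun u => e - f m u) = (fun u => 1 * e + (-1) * f m u).
      by apply/funext => w; rewrite mul1r mulN1r.
    by rewrite averages_comb averages_cst mul1r mulN1r.
  have : averages Hs (k + m) j G v <= a m0 (m - m0 + j)%N v + e.
    rewrite /a averages_add -addnA subnKC //.
    by apply: averages_le v1 => w w1; exact: hJ0.
  have /andP[_ h1] := hJ' (m - m0 + j)%N (leq_trans (leq_maxr J J') (leq_addl _ _)) v vs.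
  have /andP[h2 _] := hJ j (leq_maxl J J') v vs.
  lra.
apply: le_trans (_ : \sum_(v <- s) 5 * e <= _).
  by rewrite big_seq [leRHS]big_seq ler_sum.
by rewrite big_const_seq count_predT iter_addr_0 -mulr_natr; lra.
Qed.

Lemma stable_of_cauchy_averages D Hs :
  family_F D -> (forall m, proper_subspace (Hs m)) ->
  (forall k K, convex_body K ->
     uniformly_cauchy (fun m => averages Hs k m (support K))) ->
  stable D Hs.
Proof.
move=> fD pH cauchy k K bK.
have bP m : convex_body (process D Hs k m K) by exact: process_body.
have -> : successive D Hs k K = fun j => process D Hs k j.+1 K.
  by apply/funext => j; exact: successiveE.
apply: body_complete => [m|e e0]; first exact: bP.
have [N hN] := cauchy_process k fD pH cauchy bK e0.
exists N => i j Ni Nj u; apply: support_le_sphere => // v.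
by apply: hN; rewrite leqW.
Qed.

End MinkowskiDomination.
(** * Functions with controlled second differences *)

Section Controlled.
Variables (R : realType) (n : nat).
Implicit Types (x y u v w p q : 'rV[R]_n) (c d e t C : R).
Implicit Types (H : {vspace 'rV[R]_n}) (Hs : nat -> {vspace 'rV[R]_n}).
Implicit Types (f g : 'rV[R]_n -> R).

(** A derivative-free bound for [f] in [C^{1,1}] on the ball of radius [2], which
    contains with some margin the sublevel sets considered later: values,
    Lipschitz constant and deviation from affine functions on segments. *)
Definition controlled C f : Prop :=
  [/\ continuous f,
    forall x, enorm x <= 2 -> `|f x| <= C,
    forall x y, enorm x <= 2 -> enorm y <= 2 -> f x - f y <= C * enorm (x - y) &
    forall x y t, enorm x <= 2 -> enorm y <= 2 -> 0 <= t -> t <= 1 ->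
      `|f (t *: x + (1 - t) *: y) - (t * f x + (1 - t) * f y)|
        <= C * (t * (1 - t) * enorm (x - y) ^+ 2)].

Lemma enorm_segment x y t c : 0 <= t -> t <= 1 -> enorm x <= c -> enorm y <= c ->
  enorm (t *: x + (1 - t) *: y) <= c.
Proof.
move=> t0 t1 xc yc.
have c0 : 0 <= c by apply: le_trans xc; exact: enorm_ge0.
by have [_ _ /convex_setP vB] := eball_body n c0; exact: vB.
Qed.

Lemma controlled_ge0 C f : controlled C f -> 0 <= C.
Proof.
by move=> [_ h _ _]; apply: le_trans (h 0 _); rewrite ?normr_ge0 // enorm0.
Qed.

Lemma controlled_le C C' f : C <= C' -> controlled C f -> controlled C' f.
Proof.
move=> CC [c0 c1 c2 c3]; split=> // [x x2|x y x2 y2|x y t x2 y2 t0 t1].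
- exact: le_trans (c1 x x2) CC.
- by apply: le_trans (c2 x y x2 y2) _; rewrite ler_wpM2r ?enorm_ge0.
- apply: le_trans (c3 x y t x2 y2 t0 t1) _.
  by rewrite ler_wpM2r // !mulr_ge0 ?subr_ge0 ?enorm_ge0.
Qed.

Lemma controlled_cst c : controlled `|c| (fun=> c).
Proof.
split=> [|x _|x y _ _|x y t _ _ t0 t1] //; first exact: cst_continuous.
  by rewrite subrr mulr_ge0 ?enorm_ge0 ?normr_ge0.
have -> : c - (t * c + (1 - t) * c) = 0 by ring.
by rewrite normr0 !mulr_ge0 ?subr_ge0 ?enorm_ge0 ?normr_ge0.
Qed.

Lemma controlled_dot p : controlled (2 * enorm p) (fun x => dot x p).
Proof.
have dotn x y : `|dot x y| <= enorm x * enorm y.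
  by rewrite ler_norml dot_le_enorm andbT lerNl -dotNl -[enorm x]enormN dot_le_enorm.
have p0 := enorm_ge0 p.
split=> [|x x2|x y _ _|x y t _ _ t0 t1]; first exact: dotl_continuous.
- by apply: le_trans (dotn x p) _; rewrite ler_wpM2r.
- rewrite -dotBl (le_trans (dot_le_enorm _ _)) // mulrC ler_wpM2r ?enorm_ge0 //.
  lra.
by rewrite dotDl !dotZl subrr normr0 !mulr_ge0 ?subr_ge0 ?enorm_ge0.
Qed.

Lemma controlledD C D f g : controlled C f -> controlled D g ->
  controlled (C + D) (fun x => f x + g x).
Proof.
move=> [c0 c1 c2 c3] [d0 d1 d2 d3]; split=> [x|x x2|x y x2 y2|x y t x2 y2 t0 t1].
- exact: cvgD (c0 x) (d0 x).
- by apply: le_trans (ler_normD _ _) _; apply: lerD; [exact: c1 | exact: d1].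
- by have := c2 x y x2 y2; have := d2 x y x2 y2; lra.
have -> : f (t *: x + (1 - t) *: y) + g (t *: x + (1 - t) *: y) -
    (t * (f x + g x) + (1 - t) * (f y + g y)) =
  (f (t *: x + (1 - t) *: y) - (t * f x + (1 - t) * f y)) +
  (g (t *: x + (1 - t) *: y) - (t * g x + (1 - t) * g y)) by ring.
rewrite [leRHS]mulrDl; apply: le_trans (ler_normD _ _) _.
by apply: lerD; [exact: c3 | exact: d3].
Qed.

Lemma controlledM C D f g : controlled C f -> controlled D g ->
  controlled (3 * C * D) (fun x => f x * g x).
Proof.
move=> cf cg; have C0 := controlled_ge0 cf; have D0 := controlled_ge0 cg.
move: cf cg => [c0 c1 c2 c3] [d0 d1 d2 d3].
have c2' x y : enorm x <= 2 -> enorm y <= 2 -> `|f x - f y| <= C * enorm (x - y).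
  by move=> x2 y2; rewrite ler_norml lerNl opprB [in X in X && _]enormC !c2.
have d2' x y : enorm x <= 2 -> enorm y <= 2 -> `|g x - g y| <= D * enorm (x - y).
  by move=> x2 y2; rewrite ler_norml lerNl opprB [in X in X && _]enormC !d2.
split=> [x|x x2|x y x2 y2|x y t x2 y2 t0 t1].
- exact: cvgM (c0 x) (d0 x).
- have := ler_pM (normr_ge0 _) (normr_ge0 _) (c1 x x2) (d1 x x2).
  rewrite normrM; have : 0 <= C * D by exact: mulr_ge0. lra.
- have -> : f x * g x - f y * g y = f x * (g x - g y) + (f x - f y) * g y by ring.
  have h1 := ler_pM (normr_ge0 _) (normr_ge0 _) (c1 x x2) (d2' x y x2 y2).
  have h2 := ler_pM (normr_ge0 _) (normr_ge0 _) (c2' x y x2 y2) (d1 y y2).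
  have h3 := ler_norm (f x * (g x - g y)); have h4 := ler_norm ((f x - f y) * g y).
  rewrite -!normrM in h1 h2.
  have : 0 <= C * D * enorm (x - y) by rewrite !mulr_ge0 ?enorm_ge0.
  lra.
(* on a segment, the product deviates from affine by the deviations of the factors
   and by the product of their increments *)
set z := t *: x + _; set F := t * f x + (1 - t) * f y; set G := t * g x + (1 - t) * g y.
have z2 : enorm z <= 2 by exact: enorm_segment.
have t1' : 0 <= 1 - t by rewrite subr_ge0.
have FC : `|F| <= C.
  have := ler_wpM2l t0 (c1 x x2); have := ler_wpM2l t1' (c1 y y2).
  have := ler_normD (t * f x) ((1 - t) * f y).
  rewrite !normrM (ger0_norm t0) (ger0_norm t1') -/F; lra.
have -> : f z * g z - (t * (f x * g x) + (1 - t) * (f y * g y)) =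
  (f z - F) * g z + F * (g z - G) - t * (1 - t) * ((f x - f y) * (g x - g y)).
  by rewrite /F /G; ring.
set d2n := enorm (x - y) ^+ 2.
have h1 := ler_pM (normr_ge0 _) (normr_ge0 _) (c3 x y t x2 y2 t0 t1) (d1 z z2).
have h2 := ler_pM (normr_ge0 _) (normr_ge0 _) FC (d3 x y t x2 y2 t0 t1).
have h3 := ler_pM (normr_ge0 _) (normr_ge0 _) (c2' x y x2 y2) (d2' x y x2 y2).
rewrite -/z -/F -/G -!normrM -/d2n in h1 h2 h3.
have tt : 0 <= t * (1 - t) by rewrite mulr_ge0.
have {}h3 := ler_wpM2l tt h3.
have -> : 3 * C * D * (t * (1 - t) * d2n) = C * (t * (1 - t) * d2n) * D +
  C * (D * (t * (1 - t) * d2n)) + t * (1 - t) * (C * enorm (x - y) * (D * enorm (x - y))).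
  by rewrite /d2n; ring.
apply: le_trans (ler_normB _ _) _; apply: lerD.
  by apply: le_trans (ler_normD _ _) _; apply: lerD.
by rewrite normrM (ger0_norm tt).
Qed.

Lemma controlledZ C c f : controlled C f -> controlled (`|c| * C) (fun x => c * f x).
Proof.
move=> cf; have C0 := controlled_ge0 cf; move: cf => [c0 c1 c2 c3].
split=> [x|x x2|x y x2 y2|x y t x2 y2 t0 t1].
- exact: cvgM (cvg_cst c) (c0 x).
- by rewrite normrM ler_wpM2l // c1.
- rewrite -mulrBr (le_trans (ler_norm _)) // normrM -[leRHS]mulrA ler_wpM2l //.
  by rewrite ler_norml lerNl opprB [in X in X && _]enormC !c2.
have -> : c * f (t *: x + (1 - t) *: y) - (t * (c * f x) + (1 - t) * (c * f y)) =
  c * (f (t *: x + (1 - t) *: y) - (t * f x + (1 - t) * f y)) by ring.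
by rewrite normrM -[leRHS]mulrA ler_wpM2l // c3.
Qed.

Lemma controlled_average C H f : controlled C f -> controlled C (average H f).
Proof.
move=> [c0 c1 c2 c3].
split=> [x|x x2|x y x2 y2|x y t x2 y2 t0 t1].
- apply: (@cvgM _ _ (nbhs x)); last exact: cvg_cst.
  apply: (@cvgD _ _ _ (nbhs x)); first exact: c0.
  exact: (continuous_comp (@reflection_continuous _ _ H x) (c0 _)).
- have := c1 x x2; have := c1 (reflection H x); rewrite enorm_reflection /average.
  by move=> /(_ x2); rewrite !ler_norml => /andP[? ?] /andP[? ?]; apply/andP; split; lra.
- have := c2 x y x2 y2; have := c2 (reflection H x) (reflection H y).
  by rewrite -reflectionB !enorm_reflection /average => /(_ x2 y2); lra.
have := c3 x y t x2 y2 t0 t1.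
have := c3 (reflection H x) (reflection H y) t.
rewrite -reflectionB !enorm_reflection -!reflectionZ -reflectionD.
move=> /(_ x2 y2 t0 t1); rewrite !ler_norml /average => /andP[? ?] /andP[? ?].
by apply/andP; split; lra.
Qed.

Lemma controlled_sum (J : finType) (Theta : J -> 'rV[R]_n -> R) (s : J -> R) C :
  (forall i, controlled C (Theta i)) ->
  controlled (\sum_i `|s i| * C) (fun x => \sum_i s i * Theta i x).
Proof.
move=> cT; elim: (index_enum J) => [|i r IH].
  rewrite big_nil; have := controlled_cst 0; rewrite normr0.
  by congr controlled; apply/funext => x; rewrite big_nil.
rewrite big_cons; have := controlledD (controlledZ (s i) (cT i)) IH.
by congr controlled; apply/funext => x; rewrite big_cons.
Qed.

End Controlled.

(** * Functions with square-summable averaging steps *)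

Section Tame.
Variables (R : realType) (n : nat).
Implicit Types (x y u v w p q : 'rV[R]_n) (c d e t C : R).
Implicit Types (H : {vspace 'rV[R]_n}) (Hs : nat -> {vspace 'rV[R]_n}).
Implicit Types (f g : 'rV[R]_n -> R).

(** The features span a finite-dimensional space of functions on which every
    reflection acts, isometrically for the Euclidean norm of coefficients: the
    condition on [rho] says that its rows are orthonormal. *)
Definition orthogonal_features (J : finType) (Theta : J -> 'rV[R]_n -> R) : Prop :=
  forall H, exists2 rho : J -> J -> R,
    forall x i, Theta i (reflection H x) = \sum_j rho i j * Theta j x &
    forall i i', \sum_j rho i j * rho i' j = (i == i')%:R.

Definition tame f : Prop :=
  exists (J : finType) (Theta : J -> 'rV[R]_n -> R) (C : R) (s : J -> R),
  [/\ orthogonal_features Theta, forall i, controlled C (Theta i) &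
     forall x, f x = \sum_i s i * Theta i x].

Lemma tame_cst c : tame (fun=> c).
Proof.
exists unit, (fun _ _ => 1), `|1|, (fun=> c).
split=> [H|_|x]; last by rewrite (bigD1 tt) //= big1 ?mulr1 ?addr0 // => -[].
  have su (F : unit -> R) : \sum_i F i = F tt.
    by rewrite (bigD1 tt) //= big1 ?addr0 // => -[].
  by exists (fun _ _ => 1) => [x i|[] []]; rewrite su ?mulr1.
exact: controlled_cst.
Qed.

(** The coordinates are the features; a reflection acts on them by its matrix. *)
Lemma tame_dot p : tame (fun x => dot x p).
Proof.
pose b (i : 'I_n) : 'rV[R]_n := delta_mx 0 i.
have bE x i : dot x (b i) = x 0 i.
  rewrite /dot (bigD1 i) //= big1 ?addr0; first by rewrite mxE !eqxx mulr1.
  by move=> j ji; rewrite mxE eqxx (negbTE ji) mulr0.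
have b1 i : enorm (b i) = 1 by rewrite /enorm bE mxE !eqxx sqrtr1.
exists 'I_n, (fun i x => x 0 i), 2, (fun i => p 0 i); split=> [H|i|x].
- exists (fun i j => reflection H (b i) 0 j) => [x i|i j].
    rewrite -bE dot_reflectionl dotC; exact: eq_bigr.
  rewrite -[LHS]/(dot _ _) dot_reflection2 bE mxE eqxx /=.
  by rewrite eq_sym.
- have := controlled_dot (b i); rewrite b1 mulr1.
  by congr controlled; apply/funext => x; exact: bE.
- by apply: eq_bigr => i _; rewrite mulrC.
Qed.

(** Features of a sum are the disjoint union of the features, with the
    block-diagonal action. *)
Lemma tameD f g : tame f -> tame g -> tame (fun x => f x + g x).
Proof.
move=> [J [Th [C [s [oT cT fE]]]]] [J' [Th' [C' [s' [oT' cT' gE]]]]].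
pose U (i : J + J') := match i with inl j => Th j | inr j => Th' j end.
pose V (i : J + J') := match i with inl j => s j | inr j => s' j end.
have C0 (i : J) : 0 <= C by exact: controlled_ge0 (cT i).
have C'0 (i : J') : 0 <= C' by exact: controlled_ge0 (cT' i).
exists (J + J')%type, U, (`|C| + `|C'|), V; split=> [H|[] i|x].
- have [rho r1 r2] := oT H; have [rho' r1' r2'] := oT' H.
  exists (fun i j => match i, j with inl a, inl b => rho a b
    | inr a, inr b => rho' a b | _, _ => 0 end).
    move=> x [] i; rewrite big_sumType /= ?r1 ?r1'.
      by rewrite [X in _ + X]big1 ?addr0 // => ? _; rewrite mul0r.
    by rewrite [X in X + _]big1 ?add0r // => ? _; rewrite mul0r.
  move=> [] i [] j; rewrite big_sumType /=.
  + by rewrite r2 [X in _ + X]big1 ?addr0 // => ? _; rewrite mul0r.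
  + by rewrite !big1 ?addr0 // => ? _; rewrite ?mul0r ?mulr0.
  + by rewrite !big1 ?addr0 // => ? _; rewrite ?mul0r ?mulr0.
  + by rewrite r2' [X in X + _]big1 ?add0r // => ? _; rewrite mul0r.
- by apply: controlled_le (cT i); rewrite ger0_norm ?(C0 i) // lerDl.
- by apply: controlled_le (cT' i); rewrite [`|C'|]ger0_norm ?(C'0 i) // lerDr.
- by rewrite fE gE big_sumType.
Qed.

(** Features of a product are the products of features, with the tensor product
    action. *)
Lemma tameM f g : tame f -> tame g -> tame (fun x => f x * g x).
Proof.
move=> [J [Th [C [s [oT cT fE]]]]] [J' [Th' [C' [s' [oT' cT' gE]]]]].
exists (J * J')%type, (fun i x => Th i.1 x * Th' i.2 x), (3 * C * C'),
  (fun i => s i.1 * s' i.2); split=> [H|i|x].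
- have [rho r1 r2] := oT H; have [rho' r1' r2'] := oT' H.
  exists (fun i j => rho i.1 j.1 * rho' i.2 j.2) => [x i|[i i'] [j j']] /=.
    rewrite r1 r1' big_distrlr /= pair_bigA /=.
    by apply: eq_bigr => k _; rewrite mulrACA.
  transitivity ((\sum_k rho i k * rho j k) * (\sum_k rho' i' k * rho' j' k)).
    rewrite big_distrlr /= pair_bigA /=; apply: eq_bigr => k _.
    by rewrite mulrACA.
  by rewrite r2 r2' xpair_eqE -natrM mulnb.
- exact: controlledM.
- rewrite fE gE big_distrlr /= pair_bigA /=; apply: eq_bigr => k _.
  by rewrite mulrACA.
Qed.

Lemma tameZ c f : tame f -> tame (fun x => c * f x).
Proof. by move=> tf; exact: tameM (tame_cst c) tf. Qed.

(** The coefficients of an average are the midpoint of two vectors of equal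
    Euclidean norm, so the squared steps of the coefficients telescope. The norm of
    the coefficients bounds the Lipschitz constant of a combination of finitely many
    features, so the Lipschitz constants of the steps are square-summable. *)
Lemma tame_averages f : tame f -> exists2 C, 1 <= C &
  forall Hs k, exists2 eta : nat -> R,
    (forall m, 0 <= eta m) /\ (forall m, \sum_(i < m) eta i ^+ 2 <= C) &
    forall m, controlled C (averages Hs k m f) /\
      forall x y, enorm x <= 2 -> enorm y <= 2 ->
        (averages Hs k m f x - averages Hs k m.+1 f x) -
        (averages Hs k m f y - averages Hs k m.+1 f y) <= eta m * enorm (x - y).
Proof.
move=> [J [Th [C0 [s [oT cT0 fE]]]]].
pose C := `|C0|; have cT i : controlled C (Th i).
  by apply: controlled_le (cT0 i); exact: ler_norm.
pose N (s : J -> R) := \sum_j s j ^+ 2.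
have N0 r : 0 <= N r by apply: sumr_ge0 => j _; exact: sqr_ge0.
pose B := C * #|J|%:R.
have B0 : 0 <= B by rewrite mulr_ge0 ?normr_ge0 ?ler0n.
have ctrl r : controlled (B * Num.sqrt (N r)) (fun x => \sum_i r i * Th i x).
  apply: controlled_le (controlled_sum r cT).
  have -> : B * Num.sqrt (N r) = \sum_(i : J) Num.sqrt (N r) * C.
    by rewrite sumr_const /B -mulr_natr; ring.
  apply: ler_sum => i _; rewrite ler_wpM2r ?normr_ge0 // -sqrtr_sqr ler_wsqrtr //.
  by rewrite /N (bigD1 i) //= lerDl sumr_ge0 // => j _; exact: sqr_ge0.
exists (1 + B * Num.sqrt (N s) + B ^+ 2 * N s).
  by rewrite -addrA lerDl addr_ge0 // mulr_ge0 ?sqrtr_ge0 ?sqr_ge0.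
move=> Hs k.
have [rho rhoP] : exists rho : nat -> J -> J -> R, forall m,
    (forall x i, Th i (reflection (Hs (k + m)%N) x) = \sum_j rho m i j * Th j x) /\
    (forall i i', \sum_j rho m i j * rho m i' j = (i == i')%:R).
  suff /choice[rho rP] : forall m, exists r : J -> J -> R,
    (forall x i, Th i (reflection (Hs (k + m)%N) x) = \sum_j r i j * Th j x) /\
    (forall i i', \sum_j r i j * r i' j = (i == i')%:R) by exists rho.
  by move=> m; have [r r1 r2] := oT (Hs (k + m)%N); exists r.
pose tr m (r : J -> R) j := \sum_i rho m i j * r i.
pose T := fix T m : J -> R :=
  if m is m'.+1 then fun j => (T m' j + tr m' (T m') j) / 2 else s.
have avE m x : averages Hs k m f x = \sum_j T m j * Th j x.
  elim: m x => [|m IH] x; first exact: fE.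
  have [r1 _] := rhoP m; rewrite /= /average !IH.
  have -> : \sum_j T m j * Th j (reflection (Hs (k + m)%N) x) =
      \sum_j tr m (T m) j * Th j x.
    under eq_bigr do rewrite r1 mulr_sumr.
    rewrite exchange_big; apply: eq_bigr => j _; rewrite /tr mulr_suml.
    by apply: eq_bigr => i _; ring.
  rewrite -big_split mulr_suml; apply: eq_bigr => j _ /=; by field.
have trN m r : N (tr m r) = N r.
  have [_ r2] := rhoP m; rewrite /N /tr.
  under eq_bigr do rewrite expr2 big_distrlr /=.
  rewrite exchange_big; apply: eq_bigr => i _; rewrite exchange_big /=.
  rewrite (bigD1 i) //= [X in _ + X]big1 ?addr0 => [|i' i'i].
    transitivity (r i ^+ 2 * \sum_j rho m i j * rho m i j).
      by rewrite mulr_sumr; apply: eq_bigr => j _; ring.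
    by rewrite r2 eqxx mulr1.
  transitivity (r i * r i' * \sum_j rho m i j * rho m i' j).
    by rewrite mulr_sumr; apply: eq_bigr => j _; ring.
  by rewrite r2 eq_sym (negbTE i'i) mulr0.
pose S m := (fun j => T m j - T m.+1 j) : J -> R.
(* Pythagoras: [T m.+1] is the midpoint of [T m] and a vector of equal norm *)
have pyth m : N (T m) = N (T m.+1) + N (S m).
  have : N (T m.+1) + N (S m) = (N (T m) + N (tr m (T m))) / 2.
    rewrite /N -!big_split mulr_suml; apply: eq_bigr => j _ /=; rewrite /S /=; by field.
  by rewrite trN => ->; field.
have NT m : N (T m) + \sum_(i < m) N (S i) = N s.
  elim: m => [|m IH]; first by rewrite big_ord0 addr0.
  by rewrite big_ord_recr /= [_ + N (S m)]addrC addrA -pyth.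
exists (fun m => B * Num.sqrt (N (S m))).
  split=> m; first by rewrite mulr_ge0 ?sqrtr_ge0.
  have -> : \sum_(i < m) (B * Num.sqrt (N (S i))) ^+ 2 = B ^+ 2 * \sum_(i < m) N (S i).
    by rewrite mulr_sumr; apply: eq_bigr => i _; rewrite exprMn sqr_sqrtr.
  have : B ^+ 2 * \sum_(i < m) N (S i) <= B ^+ 2 * N s.
    by rewrite ler_wpM2l ?sqr_ge0 // -(NT m) lerDr.
  have : 0 <= B * Num.sqrt (N s) by rewrite mulr_ge0 ?sqrtr_ge0.
  lra.
move=> m; split.
  have -> : averages Hs k m f = fun x => \sum_j T m j * Th j x by exact/funext.
  apply: controlled_le (ctrl (T m)).
  have : B * Num.sqrt (N (T m)) <= B * Num.sqrt (N s).
    rewrite ler_wpM2l // ler_wsqrtr // -(NT m) lerDl sumr_ge0 //.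
  have : 0 <= B ^+ 2 * N s by rewrite mulr_ge0 ?sqr_ge0.
  lra.
move=> x y x2 y2.
have [_ _ lip _] := ctrl (S m).
have SE z : averages Hs k m f z - averages Hs k m.+1 f z = \sum_j S m j * Th j z.
  by rewrite !avE -sumrB; apply: eq_bigr => j _; rewrite /S mulrBl.
by rewrite !SE; exact: lip.
Qed.

End Tame.
(** * The Minkowski symmetral *)

Section MinkowskiSymmetral.
Variables (R : realType) (n : nat).
Implicit Types (x y u v w p q : 'rV[R]_n) (A K L : set 'rV[R]_n) (c d e t : R).
Implicit Types (H : {vspace 'rV[R]_n}) (D : set_operation R n).

(** Both the Minkowski symmetral and its restriction to fibers are images of
    compact convex sets of pairs of points under this map. *)
Lemma pair_image_body (A : set ('rV[R]_n * 'rV[R]_n)) H :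
  A !=set0 -> compact A ->
  (forall p q p' q' t, 0 <= t -> t <= 1 -> A (p, q) -> A (p', q') ->
    A (t *: p + (1 - t) *: p', t *: q + (1 - t) *: q')) ->
  convex_body [set 2^-1 *: (z.1 + reflection H z.2) | z in A].
Proof.
move=> [z Az] cA vA; split; first by exists (2^-1 *: (z.1 + reflection H z.2)), z.
  apply: continuous_compact cA; apply: continuous_subspaceT => -[p q].
  have c1 : {for (p, q), continuous (@fst 'rV[R]_n 'rV[R]_n)} by exact: cvg_fst.
  have c2 : {for (p, q), continuous (@snd 'rV[R]_n 'rV[R]_n)} by exact: cvg_snd.
  have c3 := continuous_comp c2 (@reflection_continuous R n H q).
  have c4 : {for (p, q), continuous
      (fun z : 'rV[R]_n * 'rV[R]_n => (z.1 + reflection H z.2 : 'rV[R]_n))}.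
    exact: (cvgD c1 c3).
  exact: (continuous_comp c4 (@scaler_continuous R 'rV[R]_n 2^-1 _)).
apply/convex_setP => _ _ t t0 t1 [[p q] Apq <-] [[p' q'] Apq' <-].
exists (t *: p + (1 - t) *: p', t *: q + (1 - t) *: q'); first exact: vA.
by rewrite /= reflectionD !reflectionZ; apply/rowP => i; rewrite !mxE; ring.
Qed.

Lemma minkowski_symmetralE H K :
  minkowski_symmetral H K = [set 2^-1 *: (z.1 + reflection H z.2) | z in K `*` K].
Proof.
apply/seteqP; split.
  by move=> _ [_ [p Kp [_ [q Kq <-] <-]] <-]; exists (p, q).
move=> _ [[p q] [/= Kp Kq] <-]; exists (p + reflection H q) => //.
by exists p => //; exists (reflection H q) => //; exists q.
Qed.

Lemma minkowski_body H K : convex_body K -> convex_body (minkowski_symmetral H K).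
Proof.
move=> [[x Kx] cK /convex_setP vK]; rewrite minkowski_symmetralE.
apply: pair_image_body => [||p q p' q' t t0 t1 [/= ? ?] [/= ? ?]].
- by exists (x, x).
- exact: compact_setX.
- by split=> /=; exact: vK.
Qed.

Lemma support_minkowski H K u : convex_body K ->
  average H (support K) u <= support (minkowski_symmetral H K) u.
Proof.
move=> bK; rewrite /average; have [p Kp [-> _]] := support_attained u bK.
have [q Kq [-> _]] := support_attained (reflection H u) bK.
have -> : (dot p u + dot q (reflection H u)) / 2 = dot (2^-1 *: (p + reflection H q)) u.
  by rewrite dotZl dotDl dot_reflectionl mulrC.
apply: dot_le_support; first exact: minkowski_body.
by rewrite minkowski_symmetralE; exists (p, q).
Qed.

Lemma family_sub_minkowski D H K : family_F D -> proper_subspace H ->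
  convex_body K -> D H K `<=` minkowski_symmetral H K.
Proof.
move=> fD pH bK x Dx; have [bD _] := fD.1 H pH K bK.
have [//|u|y My [z + <-]] := @separation _ _ _ x 0 (minkowski_body H bK).
  rewrite mul0r addr0; apply: le_trans (support_minkowski H u bK).
  by apply: le_trans (family_support u fD pH bK); exact: dot_le_support.
rewrite /eball /= => z0; rewrite (@enorm_eq0 _ _ z) ?addr0 //.
by apply/eqP; rewrite eq_le z0 enorm_ge0.
Qed.

End MinkowskiSymmetral.
(** * Symmetrals of perturbed balls *)

Section Sublevels.
Variables (R : realType) (n : nat).
Implicit Types (x y z u v w p q : 'rV[R]_n) (A K L : set 'rV[R]_n).
Implicit Types (c d e t C eta : R).
Implicit Types (H : {vspace 'rV[R]_n}) (Hs : nat -> {vspace 'rV[R]_n}).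
Implicit Types (f g : 'rV[R]_n -> R) (D E : set_operation R n).

Definition sublevel f c : set 'rV[R]_n :=
  [set x | enorm x <= 2 /\ (dot x x - 1) / 2 + f x <= c].

Lemma sublevel_norm C f c x : controlled C f -> C <= 1 / 16 -> c <= 1 / 16 ->
  sublevel f c x -> enorm x <= 3 / 2.
Proof.
move=> [_ fC _ _] C1 c1 [x2 hx]; apply: enorm_le_sqr; first by lra.
by have := fC x x2; rewrite ler_norml => /andP[? _]; lra.
Qed.

Lemma dot_segment x y t :
  dot (t *: x + (1 - t) *: y) (t *: x + (1 - t) *: y) =
  t * dot x x + (1 - t) * dot y y - t * (1 - t) * enorm (x - y) ^+ 2.
Proof. by rewrite sqr_enorm !dotE [dot y x]dotC; ring. Qed.

Lemma sublevel_body C f c : controlled C f -> C <= 1 / 16 -> `|c| <= 1 / 16 ->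
  convex_body (sublevel f c).
Proof.
move=> [f0 f1 f2 f3] C1; rewrite ler_norml => /andP[c0 c1]; split.
- exists 0; split; first by rewrite enorm0.
  have := f1 0; rewrite enorm0 dot0l ler_norml => /(_ (ler0n _ _)) /andP[? ?]; lra.
- apply: (@compact_of_closed_bounded _ _ _ 2); last by move=> x [].
  have -> : sublevel f c = [set x | enorm x <= 2] `&`
      [set x | (dot x x - 1) / 2 + f x <= c] by [].
  apply: closedI; first exact/closed_sublevel/enorm_continuous.
  apply: closed_sublevel => x.
  have c2 : {for x, continuous (fun y => (dot y y - 1) / 2)}.
    apply: (@cvgM _ _ (nbhs x)); last exact: cvg_cst.
    apply: (@cvgB _ _ _ (nbhs x)); last exact: cvg_cst.
    exact: dotxx_continuous.
  exact: (cvgD c2 (f0 x)).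
apply/convex_setP => x y t t0 t1 [x2 hx] [y2 hy].
split; first exact: enorm_segment.
have := f3 x y t x2 y2 t0 t1; rewrite dot_segment ler_norml => /andP[_ h].
have t1' : 0 <= 1 - t by rewrite subr_ge0.
have := ler_wpM2l t0 hx; have := ler_wpM2l t1' hy.
have d0 : 0 <= t * (1 - t) * enorm (x - y) ^+ 2 by rewrite !mulr_ge0 ?enorm_ge0.
have := ler_wpM2r d0 C1; lra.
Qed.

(** With [z = (p + R q) / 2], the odd part [f - average H f] contributes a
    first-order term in [p - R q], which the strict convexity of the squared norm
    absorbs up to the square of its Lipschitz constant. *)
Lemma family_sublevel_sub D H C f c eta : family_F D -> proper_subspace H ->
  controlled C f -> C <= 1 / 16 -> `|c| <= 1 / 16 ->
  (forall x y, enorm x <= 2 -> enorm y <= 2 ->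
    (f x - average H f x) - (f y - average H f y) <= eta * enorm (x - y)) ->
  D H (sublevel f c) `<=` sublevel (average H f) (c + eta ^+ 2).
Proof.
move=> fD pH cf C1 c1 lip z /(family_sub_minkowski fD pH (sublevel_body cf C1 c1)).
rewrite minkowski_symmetralE => -[[p q] /= [[p2 hp] [q2 hq]] <-].
pose s := average H f.
have cs : controlled C s by exact: controlled_average.
have [_ _ _ s3] := cs.
have sR x : s (reflection H x) = s x by rewrite /s /average reflectionK addrC.
have Rq2 : enorm (reflection H q) <= 2 by rewrite enorm_reflection.
have half : 1 - 2^-1 = 2^-1 :> R by field.
have e1 : 2^-1 *: (p + reflection H q) = 2^-1 *: p + (1 - 2^-1) *: reflection H q.
  by rewrite half scalerDr.
have i0 : 0 <= 2^-1 :> R by rewrite invr_ge0.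
have i1 : 2^-1 <= 1 :> R by rewrite invf_le1 // ler1n.
rewrite e1; split; first exact: enorm_segment.
have := s3 p (reflection H q) 2^-1 p2 Rq2 i0 i1.
rewrite dot_segment dot_reflection2 sR -/s half ler_norml => /andP[_ hs].
set dd := enorm (p - reflection H q) in hs *.
have d0 : 0 <= dd ^+ 2 by exact: sqr_ge0.
have := ler_wpM2r d0 C1.
have := lip (reflection H q) p Rq2 p2; rewrite -/s sR enormC -/dd.
have : f (reflection H q) + f q = 2 * s q by rewrite /s /average; field.
have := sqr_ge0 (dd / 4 - eta).
have -> : (dd / 4 - eta) ^+ 2 = dd ^+ 2 / 16 - eta * dd / 2 + eta ^+ 2 by field.
lra.
Qed.

(** On the line through [z] perpendicular to [H] the even part
    [psi tau = |z + tau w|^2 / 2 + s (z + tau w)], with [w] the projection of [z]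
    on [perp H], is symmetric about [tau = -1]. Shifting by the [tau] of size
    [O(eta / |w|)] that lowers [psi] by the value [a z] of the odd part makes the
    two endpoints [z + tau w] and [R z + tau w] lie in the larger sublevel set, up
    to second-order terms. When [|w|] itself is of order [eta] no shift is
    needed. *)
Lemma sublevel_chord H C f c eta z :
  controlled C f -> C <= 1 / 16 -> c <= 1 / 16 -> eta <= 1 / 16 -> 0 <= eta ->
  (forall x y, enorm x <= 2 -> enorm y <= 2 ->
    (f x - average H f x) - (f y - average H f y) <= eta * enorm (x - y)) ->
  sublevel (average H f) c z -> 0 <= f z - average H f z ->
  exists p q, [/\ sublevel f (c + 36 * eta ^+ 2) p, sublevel f (c + 36 * eta ^+ 2) q,
    p - q \in perp H & 2^-1 *: (p + reflection H q) = z].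
Proof.
move=> cf C1 c1 eta1 eta0 lip zs az.
pose s := average H f; rewrite -/s in lip zs az.
have cs : controlled C s by exact: controlled_average.
have [s0 _ _ s3] := cs.
have sR x : s (reflection H x) = s x by rewrite /s /average reflectionK addrC.
have aR x : f (reflection H x) = 2 * s x - f x by rewrite /s /average; field.
have z32 := sublevel_norm cs C1 c1 zs.
have [z2 hz] := zs.
set w := proj_perp H z.
have wp : w \in perp H by exact: mem_proj_perp.
have zRz : z - reflection H z = 2 *: w by exact: sub_reflection.
have Rz2 : enorm (reflection H z) <= 2 by rewrite enorm_reflection.
have w0 := enorm_ge0 w.
have azw : f z - s z <= eta * enorm w.
  have := lip z (reflection H z) z2 Rz2; rewrite zRz enormZ ger0_norm // sR aR.
  by lra.
have sq0 : 0 <= eta ^+ 2 by exact: sqr_ge0.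
have [w4|w4] := lerP (enorm w) (4 * eta).
  exists z, (reflection H z); split.
  - split=> //; have := ler_wpM2l eta0 w4; lra.
  - split=> //; rewrite dot_reflection2 aR; lra.
  - exact: sub_reflection_perp.
  - by rewrite reflectionK; apply/rowP => i; rewrite !mxE; field.
have wn0 : 0 < enorm w by lra.
pose psi (tau : R) := dot (z + tau *: w) (z + tau *: w) / 2 + s (z + tau *: w).
have path tau : z + tau *: w = (- tau / 2) *: reflection H z + (1 - - tau / 2) *: z.
  have -> : reflection H z = z - 2 *: w by rewrite -zRz subKr.
  by apply/rowP => i; rewrite !mxE; field.
(* under the shift by [- (2 * th)], [psi] drops by at least the odd part *)
pose th := 2 * eta / enorm w.
have thw : th * enorm w = 2 * eta by rewrite /th divfK // gt_eqF.
have th0 : 0 <= th by rewrite divr_ge0 // mulr_ge0.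
have th1 : th <= 1 / 2 by rewrite /th ler_pdivrMr //; lra.
have drop : psi (- (2 * th)) <= psi 0 - (f z - s z).
  have -> : psi 0 = dot z z / 2 + s z by rewrite /psi scale0r addr0.
  rewrite /psi path; have -> : - - (2 * th) / 2 = th by field.
  have th1' : th <= 1 by lra.
  have := s3 (reflection H z) z th Rz2 z2 th0 th1'.
  rewrite dot_segment dot_reflection2 sR enormC zRz enormZ [`|2|]ger0_norm // ler_norml.
  move=> /andP[_ hs].
  have e1 : th * (1 - th) * (2 * enorm w) ^+ 2 = 4 * (1 - th) * (2 * eta) * enorm w.
    by rewrite -thw; ring.
  rewrite e1 in hs *.
  have ew0 : 0 <= eta * enorm w by exact: mulr_ge0.
  have h1 : 4 * (1 - th) * (2 * eta) * enorm w >= 4 * (eta * enorm w).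
    have := ler_wpM2r ew0 (_ : 1 / 2 <= 1 - th); lra.
  have h2 : 0 <= 4 * (1 - th) * (2 * eta) * enorm w by lra.
  have := ler_wpM2r h2 C1; lra.
have cpsi : {within `[- (2 * th), 0], continuous psi}.
  apply: continuous_subspaceT => tau.
  have cl : {for tau, continuous (fun t : R => z + t *: w)}.
    apply: (@cvgD _ _ _ (nbhs tau)); first exact: cvg_cst.
    exact: (@scalel_continuous _ _ w tau).
  have c2 := continuous_comp cl (@dotxx_continuous R n _).
  have c3 := continuous_comp cl (s0 _).
  apply: (@cvgD _ _ _ (nbhs tau)); last exact: c3.
  by apply: (@cvgM _ _ (nbhs tau)); [exact: c2 | exact: cvg_cst].
have [tau tauI ptau] : exists2 tau, tau \in `[- (2 * th), 0] &
    psi tau = psi 0 - (f z - s z).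
  apply: IVT => //; first by lra.
  rewrite ge_min drop /= le_max; apply/orP; right; lra.
move: tauI; rewrite in_itv /= => /andP[tau1 tau0].
have tw : `|tau| * enorm w <= 4 * eta.
  rewrite ler0_norm //; have : - tau * enorm w <= 2 * th * enorm w.
    by rewrite ler_wpM2r // lerNl.
  lra.
pose p := z + tau *: w; pose p' := z - tau *: w.
have Rp' : reflection H p' = reflection H z + tau *: w.
  by rewrite reflectionB reflectionZ (reflection_perp wp) scalerN opprK.
have p2 : enorm p <= 2.
  by rewrite /p path; apply: enorm_segment => //; lra.
have p'2 : enorm p' <= 2.
  by apply: le_trans (ler_enormB _ _) _; rewrite enormZ; lra.
have lipz x y : x = y + tau *: w \/ y = x + tau *: w -> enorm x <= 2 -> enorm y <= 2 ->
    (f x - s x) - (f y - s y) <= 4 * eta ^+ 2.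
  move=> xy x2 y2; apply: le_trans (lip x y x2 y2) _.
  have -> : enorm (x - y) = `|tau| * enorm w.
    case: xy => ->; first by rewrite addrAC subrr add0r enormZ.
    by rewrite opprD addrA subrr add0r enormN enormZ.
  by have := ler_wpM2l eta0 tw; lra.
have pp' : enorm (p - p') = 2 * (`|tau| * enorm w).
  have -> : p - p' = (2 * tau) *: w by apply/rowP => i; rewrite !mxE; ring.
  by rewrite enormZ normrM ger0_norm // mulrA.
have half : 1 - 2^-1 = 2^-1 :> R by field.
have i0 : 0 <= 2^-1 :> R by rewrite invr_ge0.
have i1 : 2^-1 <= 1 :> R by rewrite invf_le1 // ler1n.
have zmid : 2^-1 *: p + (1 - 2^-1) *: p' = z.
  by rewrite half; apply/rowP => i; rewrite !mxE; field.
have hp : dot p p / 2 + s p = dot z z / 2 + s z - (f z - s z).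
  by move: ptau; rewrite /psi scale0r addr0.
have hp' : dot p' p' / 2 + s p' <= dot z z / 2 + s z + (f z - s z) + 32 * eta ^+ 2.
  have := s3 p p' 2^-1 p2 p'2 i0 i1; rewrite zmid ler_norml => /andP[h1 _].
  have := dot_segment p p' 2^-1; rewrite zmid => h2.
  rewrite half pp' in h1 h2.
  have tw2 : (`|tau| * enorm w) ^+ 2 <= 16 * eta ^+ 2.
    have -> : 16 * eta ^+ 2 = (4 * eta) ^+ 2 by ring.
    by rewrite ler_pXn2r // nnegrE mulr_ge0.
  have tw0 : 0 <= (`|tau| * enorm w) ^+ 2 by exact: sqr_ge0.
  have := ler_wpM2r tw0 C1; lra.
exists p, (reflection H p'); split.
- split=> //; have := lipz p z (or_introl erefl) p2 z2; lra.
- split; first by rewrite enorm_reflection.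
  rewrite dot_reflection2 aR.
  have : z = p' + tau *: w by rewrite /p' subrK.
  by move=> e1; have := lipz z p' (or_introl e1) z2 p'2; lra.
- rewrite Rp' /p opprD addrACA subrr addr0; exact: sub_reflection_perp.
- by rewrite reflectionK -zmid half scalerDr.
Qed.

(** By [family_segment] the chord of [sublevel_chord] is moved to a segment with
    endpoint [z]. *)
Lemma family_sublevel_sup D H C f c eta : family_F D -> proper_subspace H ->
  controlled C f -> C <= 1 / 16 -> `|c| <= 1 / 16 -> `|c + 36 * eta ^+ 2| <= 1 / 16 ->
  eta <= 1 / 16 -> 0 <= eta ->
  (forall x y, enorm x <= 2 -> enorm y <= 2 ->
    (f x - average H f x) - (f y - average H f y) <= eta * enorm (x - y)) ->
  sublevel (average H f) c `<=` D H (sublevel f (c + 36 * eta ^+ 2)).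
Proof.
move=> fD pH cf C1; rewrite ler_norml => /andP[_ c1] c2 eta1 eta0 lip z zs.
have bK := sublevel_body cf C1 c2.
have [az|/ltW az] := lerP 0 (f z - average H f z).
  have [p [q [Kp Kq pq <-]]] := sublevel_chord cf C1 c1 eta1 eta0 lip zs az.
  exact: family_segment.
(* the odd part is nonnegative at the mirror image of [z] *)
have zs' : sublevel (average H f) c (reflection H z).
  move: zs => [z2 hz]; split; first by rewrite enorm_reflection.
  by move: hz; rewrite dot_reflection2 /average reflectionK [f z + _]addrC.
have az' : 0 <= f (reflection H z) - average H f (reflection H z).
  by move: az; rewrite /average reflectionK; lra.
have [p [q [Kp Kq pq e1]]] := sublevel_chord cf C1 c1 eta1 eta0 lip zs' az'.
have -> : z = 2^-1 *: (q + reflection H p).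
  by rewrite -[z](reflectionK H) -e1 reflectionZ reflectionD reflectionK addrC.
by apply: family_segment => //; rewrite -opprB rpredN.
Qed.

End Sublevels.
(** * Stability implies convergence of averages of tame functions *)

Section Perturbation.
Variables (R : realType) (n : nat).
Implicit Types (x y z u v w p q : 'rV[R]_n) (A K L : set 'rV[R]_n).
Implicit Types (c d e t C eps : R).
Implicit Types (H : {vspace 'rV[R]_n}) (Hs : nat -> {vspace 'rV[R]_n}).
Implicit Types (f g : 'rV[R]_n -> R) (D E : set_operation R n).

Lemma sublevel_le f c d : c <= d -> sublevel f c `<=` sublevel f d.
Proof. by move=> cd x [x2 hx]; split=> //; apply: le_trans cd. Qed.

(** Each step changes the level by at most [36 (eps eta)^2], and these changes sum
    to at most [36 eps^2 C]. The condition [576 C eps <= 1] keeps all parameters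
    below the threshold [1 / 16] under which one step is controlled. *)
Lemma process_sublevel D Hs k f C eps (eta : nat -> R) : family_F D ->
  (forall m, proper_subspace (Hs m)) -> 1 <= C -> 0 < eps -> eps <= 1 ->
  576 * C * eps <= 1 ->
  (forall m, 0 <= eta m) -> (forall m, \sum_(i < m) eta i ^+ 2 <= C) ->
  (forall m, controlled C (averages Hs k m f) /\
    forall x y, enorm x <= 2 -> enorm y <= 2 ->
      (averages Hs k m f x - averages Hs k m.+1 f x) -
      (averages Hs k m f y - averages Hs k m.+1 f y) <= eta m * enorm (x - y)) ->
  forall m,
  let K := process D Hs k m (sublevel (fun x => eps * f x) 0) in
  let g x := eps * averages Hs k m f x in
  [/\ convex_body K, sublevel g (- (36 * eps ^+ 2 * C)) `<=` K
    & K `<=` sublevel g (36 * eps ^+ 2 * C)].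
Proof.
move=> fD pH C1 eps0 eps1 epsC eta0 etaC ctrl.
pose A m x := eps * averages Hs k m f x.
have cA m : controlled (eps * C) (A m).
  have [h _] := ctrl m; have := controlledZ eps h.
  by rewrite gtr0_norm.
have epsC16 : eps * C <= 1 / 16 by lra.
have sqC : 36 * eps ^+ 2 * C <= 1 / 16.
  have : eps * (eps * C) <= 1 * (eps * C).
    by rewrite ler_wpM2r // mulr_ge0 ?(ltW eps0) // (le_trans ler01).
  rewrite expr2; lra.
pose S m := \sum_(i < m) eta i ^+ 2.
have S0 m : 0 <= S m by apply: sumr_ge0 => i _; exact: sqr_ge0.
have SS m : S m.+1 = S m + eta m ^+ 2 by rewrite /S big_ord_recr.
have e20 : 0 <= 36 * eps ^+ 2 by rewrite mulr_ge0 // sqr_ge0.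
have cS m : 0 <= 36 * eps ^+ 2 * S m <= 36 * eps ^+ 2 * C.
  by rewrite mulr_ge0 //= ler_wpM2l //; exact: etaC.
have cS16 m : `|36 * eps ^+ 2 * S m| <= 1 / 16.
  by have /andP[h1 h2] := cS m; rewrite ger0_norm //; lra.
have etaC' m : eta m <= C.
  rewrite -(@ler_pXn2r R 2) ?nnegrE // ?(le_trans ler01) //.
  have := etaC m.+1; rewrite -/(S _) SS => h; have := S0 m.
  have : C <= C ^+ 2 by rewrite expr2 -{1}[C]mul1r ler_wpM2r // (le_trans ler01).
  lra.
have eeta m : eps * eta m <= 1 / 16.
  by have := ler_wpM2l (ltW eps0) (etaC' m); lra.
have eeta0 m : 0 <= eps * eta m by rewrite mulr_ge0 // ltW.
have AS m : A m.+1 = average (Hs (k + m)%N) (A m).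
  by apply/funext => x; rewrite /A /= /average; ring.
have lip m x y : enorm x <= 2 -> enorm y <= 2 ->
    (A m x - average (Hs (k + m)%N) (A m) x) - (A m y - average (Hs (k + m)%N) (A m) y)
      <= eps * eta m * enorm (x - y).
  move=> x2 y2; rewrite -AS /A; have [_ h] := ctrl m.
  by have := ler_wpM2l (ltW eps0) (h x y x2 y2); lra.
have b0 : convex_body (sublevel (A 0%N) 0).
  by apply: sublevel_body (cA 0%N) epsC16 _; rewrite normr0; lra.
have bK m : convex_body (process D Hs k m (sublevel (A 0%N) 0)).
  exact: process_body.
have main m : sublevel (A m) (- (36 * eps ^+ 2 * S m))
      `<=` process D Hs k m (sublevel (A 0%N) 0) /\
    process D Hs k m (sublevel (A 0%N) 0) `<=` sublevel (A m) (36 * eps ^+ 2 * S m).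
  elim: m => [|m [IH1 IH2]].
    by rewrite /S big_ord0 mulr0 oppr0; split.
  have [_ /(_ _ (pH (k + m)%N))[mono _ _]] := fD.
  have bn : `|- (36 * eps ^+ 2 * S m)| <= 1 / 16 by rewrite normrN.
  split.
    apply: subset_trans (mono _ _ (sublevel_body (cA m) epsC16 bn) (bK m) IH1).
    have -> : - (36 * eps ^+ 2 * S m) =
        - (36 * eps ^+ 2 * S m.+1) + 36 * (eps * eta m) ^+ 2.
      by rewrite SS; ring.
    rewrite AS; apply: family_sublevel_sup (cA m) epsC16 _ _ _ _ (lip m) => //.
      by rewrite normrN.
    have -> : - (36 * eps ^+ 2 * S m.+1) + 36 * (eps * eta m) ^+ 2 =
      - (36 * eps ^+ 2 * S m) by rewrite SS; ring.
    by [].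
  apply: subset_trans (mono _ _ (bK m) (sublevel_body (cA m) epsC16 (cS16 m)) IH2) _.
  apply: subset_trans (family_sublevel_sub fD (pH _) (cA m) epsC16 (cS16 m) (lip m)) _.
  rewrite AS; apply: sublevel_le; rewrite SS.
  have := sqr_ge0 (eps * eta m); rewrite exprMn; lra.
move=> m; have [h1 h2] := main m; have /andP[_ h3] := cS m; split; first exact: bK.
  by apply: subset_trans h1; apply: sublevel_le; rewrite lerN2.
by apply: subset_trans h2 _; exact: sublevel_le.
Qed.

(** To first order in [eps] the process started from the sublevel set of
    [(|x|^2 - 1) / 2 + eps f] only sees the averages of [f], whatever the
    symmetrization; so its convergence forces that of the averages. *)
Lemma tame_cauchy D Hs k f : family_F D -> (forall m, proper_subspace (Hs m)) ->
  stable D Hs -> tame f -> uniformly_cauchy (fun m => averages Hs k m f).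
Proof.
move=> fD pH st tf e e0.
have [C C1 /(_ Hs k)[eta [eta0 etaC] ctrl]] := tame_averages tf.
(* [eps ^+ 2 * M] is the inward shift that makes up for the second-order errors *)
pose M := 4 * C ^+ 2 + 36 * C.
have CC : 1 <= C ^+ 2 by rewrite expr2; have := ler_pM ler01 ler01 C1 C1; rewrite mulr1.
pose B := M + 2 + 37 * C + 2 * C ^+ 2 + 576 * C + 1.
have B1 : 1 <= B by rewrite /B /M; lra.
pose eps := Num.min e 1 / B.
have m0 : 0 < Num.min e 1 by rewrite lt_min e0 ltr01.
have eps0 : 0 < eps by rewrite divr_gt0 // (lt_le_trans ltr01).
have epsB : eps * B = Num.min e 1 by rewrite /eps divfK // gt_eqF // (lt_le_trans ltr01).
have epsBe : eps * B <= e by rewrite epsB ge_min lexx.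
have epsB1 : eps * B <= 1 by rewrite epsB ge_min lexx orbT.
have epsC : 576 * C * eps <= 1.
  have : eps * (576 * C) <= eps * B by rewrite ler_wpM2l ?ltW // /B /M; lra.
  lra.
have eps1 : eps <= 1.
  have : eps * 1 <= eps * B by rewrite ler_wpM2l // ltW.
  by rewrite mulr1; lra.
have epsM : eps * M <= 1.
  have : eps * M <= eps * B by rewrite ler_wpM2l ?ltW // /B; lra.
  lra.
have sandwich := process_sublevel fD pH C1 eps0 eps1 epsC eta0 etaC ctrl.
pose K := sublevel (fun x => eps * f x) 0; pose P m := process D Hs k m K.
have bP m : convex_body (P m) by have [] := sandwich m.
have [L bL] := st k K (bP 0%N).
have -> : successive D Hs k K = fun j => P j.+1.
  by apply/funext => j; exact: successiveE.
move=> /converges_support cvL.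
have d0 : 0 < eps ^+ 2 / 2 by rewrite divr_gt0 // exprn_gt0.
have [N hN] := cvL (fun m => bP m.+1) bL _ d0.
exists N.+1 => -[|j] // -[|i] // jN iN u u1.
have sub : P i.+1 `<=` msum (P j.+1) (eball (eps ^+ 2)).
  apply/body_sub_msum => //; first exact: sqr_ge0.
  move=> v; have := hN i iN v; have := hN j jN v.
  by rewrite !ler_norml => /andP[? ?] /andP[? ?]; lra.
set a := averages Hs k i.+1 f; set b := averages Hs k j.+1 f.
have [[_ a1 a2 _] _] := ctrl i.+1; have [[_ b1 b2 _] _] := ctrl j.+1.
rewrite -/a in a1 a2; rewrite -/b in b1 b2.
have u2 : enorm u <= 2 by rewrite u1 ler1n.
have := a1 u u2; rewrite ler_norml => /andP[au1 au2].
(* a point of the small sublevel set of [a] in the direction [u] *)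
pose sg := eps * a u + eps ^+ 2 * M.
have epsM2 : eps ^+ 2 * M <= eps.
  by have := ler_wpM2l (ltW eps0) epsM; rewrite mulr1 mulrA -expr2.
have M0 : 0 <= eps ^+ 2 * M by rewrite mulr_ge0 ?sqr_ge0 // /M; lra.
have sgC : `|sg| <= 2 * (eps * C).
  have := ler_wpM2l (ltW eps0) au1; have := ler_wpM2l (ltW eps0) au2.
  have : eps * 1 <= eps * C by rewrite ler_wpM2l // ltW.
  by rewrite ler_norml /sg => ? ? ?; apply/andP; split; lra.
have sg1 : `|sg| <= 1 / 2 by apply: le_trans sgC _; lra.
pose x := (1 - sg) *: u.
have xu : u - x = sg *: u by rewrite /x scalerBl scale1r subKr.
have x2 : enorm x <= 3 / 2.
  rewrite enormZ u1 mulr1; move: sg1; rewrite !ler_norml => /andP[? ?].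
  by apply/andP; split; lra.
have dxx : dot x x = (1 - sg) ^+ 2.
  by rewrite -sqr_enorm enormZ u1 mulr1 real_normK ?num_real.
have sg2 : sg ^+ 2 <= 4 * (eps ^+ 2 * C ^+ 2).
  have -> : 4 * (eps ^+ 2 * C ^+ 2) = (2 * (eps * C)) ^+ 2 by ring.
  by rewrite -(real_normK (num_real sg)) ler_pXn2r // nnegrE (le_trans _ sgC).
have eC0 : 0 <= eps * C by rewrite mulr_ge0 ?(ltW eps0) // (le_trans ler01).
have Px : P i.+1 x.
  have [_ h _] := sandwich i.+1; apply: h; split; first by lra.
  have h1 : eps * (a x - a u) <= eps * (C * `|sg|).
    rewrite ler_wpM2l ?(ltW eps0) //; apply: le_trans (a2 x u _ u2) _; first lra.
    by rewrite enormC xu enormZ u1 mulr1.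
  have h2 := ler_wpM2l eC0 sgC.
  have e1 : sg = eps * a u + eps ^+ 2 * (4 * C ^+ 2 + 36 * C) by [].
  rewrite -/a dxx sqrrB; lra.
have [y Py [z zB yz]] := sub x Px.
have xy : enorm (x - y) <= eps ^+ 2 by rewrite -yz addrC addKr.
have [_ _ /(_ y Py)[y2 hy]] := sandwich j.+1.
have e21 : eps ^+ 2 <= eps by rewrite expr2 -[leRHS]mulr1 ler_wpM2l // ltW.
have dyy : dot x x - 4 * eps ^+ 2 <= dot y y.
  have -> : dot y y = dot x x - 2 * dot x (x - y) + dot (x - y) (x - y).
    by move: (x) => x'; rewrite !dotE [dot y x']dotC; ring.
  have := dot_ge0 (x - y); have := dot_le_enorm x (x - y).
  have := ler_pM (enorm_ge0 x) (enorm_ge0 (x - y)) x2 xy; have := sqr_ge0 eps; lra.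
have uy : enorm (u - y) <= 2 * (eps * C) + eps ^+ 2.
  apply: le_trans (enorm_triangle x u y) _.
  by rewrite xu enormZ u1 mulr1; apply: lerD.
have b3 : eps * (b u - b y) <= eps * (C * (2 * (eps * C) + eps ^+ 2)).
  rewrite ler_wpM2l ?(ltW eps0) //; apply: le_trans (b2 u y u2 y2) _.
  by rewrite ler_wpM2l // (le_trans ler01).
have key : eps * b u <= eps * (a u + eps * (M + 2 + 36 * C + 2 * C ^+ 2 + C * eps)).
  have : 0 <= sg ^+ 2 by exact: sqr_ge0.
  have e1 : sg = eps * a u + eps ^+ 2 * M by [].
  move: hy dyy b3; rewrite -/b dxx sqrrB; lra.
move: key; rewrite ler_pM2l // => /le_trans; apply; rewrite lerD2l.
apply: le_trans epsBe; rewrite ler_wpM2l ?(ltW eps0) // /B.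
have : C * eps <= C * 1 by rewrite ler_wpM2l // (le_trans ler01).
lra.
Qed.

End Perturbation.
(** * Approximation of support functions by tame functions *)

Section Density.
Variables (R : realType) (n : nat).
Implicit Types (x y u v p q : 'rV[R]_n) (K : set 'rV[R]_n) (c e C : R).
Implicit Types (Hs : nat -> {vspace 'rV[R]_n}) (f g : 'rV[R]_n -> R).
Implicit Types (D : set_operation R n).

Definition approximable g : Prop := forall e, 0 < e -> exists2 f, tame f &
  forall u, enorm u = 1 -> `|g u - f u| <= e.

Lemma tame_bounded f : tame f -> exists2 C, 1 <= C &
  forall u, enorm u = 1 -> `|f u| <= C.
Proof.
move=> /tame_averages[C C1 /(_ (fun=> 0%VS) 0%N)[eta _ /(_ 0%N)[[_ h _ _] _]]].
by exists C => // u u1; apply: h; rewrite u1 ler1n.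
Qed.

(** The iteration [p := p + (f^2 - p^2) / 2], which stays polynomial in [f] and
    converges uniformly to [|f|] as long as [|f| <= 1]. *)
Fixpoint abs_iterate f m : 'rV[R]_n -> R := fun u =>
  if m is m'.+1 then
    abs_iterate f m' u + 2^-1 * (f u * f u + - 1 * (abs_iterate f m' u * abs_iterate f m' u))
  else 0.

Lemma tame_abs_iterate f m : tame f -> tame (abs_iterate f m).
Proof.
move=> tf; elim: m => [|m IH] /=; first exact: tame_cst.
exact: tameD IH (tameZ 2^-1 (tameD (tameM tf tf) (tameZ (- 1) (tameM IH IH)))).
Qed.

(** The defect [e_m] between [|f u|] and the [m]-th iterate satisfies
    [e_{m+1} <= e_m - e_m^2 / 2]. *)
Lemma abs_iterate_bound f m u : `|f u| <= 1 ->
  [/\ 0 <= abs_iterate f m u, abs_iterate f m u <= `|f u| &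
     `|f u| - abs_iterate f m u <= 2 / (m.+2)%:R].
Proof.
move=> f1; have ff : f u * f u = `|f u| * `|f u|.
  by rewrite -normrM ger0_norm // -expr2 sqr_ge0.
have a0 := normr_ge0 (f u).
elim: m => [|m [IH0 IH1 IH2]] /=; first by split=> //; rewrite subr0 divff.
rewrite ff; move: (`|f u|) (abs_iterate f m u) f1 a0 IH0 IH1 IH2 => a p a1 a0 p0 pa ap.
have h1 : (a - p) * (a + p) <= (a - p) * 2 by rewrite ler_wpM2l; lra.
have h2 : 0 <= (a - p) * (a + p) by rewrite mulr_ge0; lra.
split; [lra | lra |].
pose r : R := m.+2%:R; pose b := 2 / r.
have r2 : 2 <= r by rewrite /r ler_nat.
have br : b * r = 2 by rewrite /b divfK // gt_eqF //; lra.
have b0 : 0 <= b by rewrite divr_ge0 //; lra.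
have b1 : b <= 1 by rewrite /b ler_pdivrMr; lra.
have rS : m.+3%:R = r + 1 by rewrite /r natr1.
have h3 : (a - p) * (a - p) <= (a - p) * (a + p) by rewrite ler_wpM2l; lra.
have h4 : 0 <= (b - (a - p)) * (2 - (b + (a - p))).
  by rewrite mulr_ge0 //; [rewrite subr_ge0 | lra].
have h5 : b - b * b / 2 <= 2 / (r + 1).
  rewrite ler_pdivlMr; last lra.
  have -> : (b - b * b / 2) * (r + 1) = b * r - b * (b * r) / 2 + b - b * b / 2 by field.
  rewrite br; have : 0 <= b * b by rewrite mulr_ge0.
  lra.
rewrite rS; apply: le_trans h5; lra.
Qed.

Lemma approximable_tame f : tame f -> approximable f.
Proof. by move=> tf e e0; exists f => // u _; rewrite subrr normr0 ltW. Qed.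

Lemma approximableD f g : approximable f -> approximable g ->
  approximable (fun u => f u + g u).
Proof.
move=> af ag e e0; have e20 : 0 < e / 2 by rewrite divr_gt0.
have [f' tf hf] := af _ e20; have [g' tg hg] := ag _ e20.
exists (fun u => f' u + g' u); first exact: tameD.
move=> u u1; rewrite opprD addrACA; apply: le_trans (ler_normD _ _) _.
have := hf u u1; have := hg u u1; lra.
Qed.

Lemma approximableZ c f : approximable f -> approximable (fun u => c * f u).
Proof.
move=> af e e0; have c0 : 0 < `|c| + 1 by rewrite ltr_wpDl.
have [f' tf hf] := af (e / (`|c| + 1)) (divr_gt0 e0 c0).
exists (fun u => c * f' u) => [|u u1]; first exact: tameZ.
rewrite -mulrBr normrM; have := ler_wpM2l (normr_ge0 c) (hf u u1).
move=> /le_trans; apply; rewrite mulrA ler_pdivrMr //; lra.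
Qed.

Lemma approximable_abs f : approximable f -> approximable (fun u => `|f u|).
Proof.
move=> af e e0; have e20 : 0 < e / 2 by rewrite divr_gt0.
have [g tg hg] := af _ e20; have [C C1 gC] := tame_bounded tg.
have C0 : 0 < C by lra.
pose h u := C^-1 * g u; have th : tame h by exact: tameZ.
have h1 u : enorm u = 1 -> `|h u| <= 1.
  move=> u1; rewrite /h normrM gtr0_norm ?invr_gt0 // mulrC ler_pdivrMr // mul1r.
  exact: gC.
pose m := Num.truncn (4 * C / e).
exists (fun u => C * abs_iterate h m u); first exact/tameZ/tame_abs_iterate.
move=> u u1; have [p0 p1 p2] := abs_iterate_bound m (h1 u u1).
have ghu : `|g u| = C * `|h u|.
  by rewrite /h normrM gtr0_norm ?invr_gt0 // mulrA divff ?gt_eqF // mul1r.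
have big : C * (2 / m.+2%:R) <= e / 2.
  have hm : 4 * C / e < m.+1%:R by exact: truncnS_gt.
  rewrite mulrA ler_pdivrMr ?ltr0n //.
  move: hm; rewrite ltr_pdivrMr // => hm.
  have : m.+1%:R <= m.+2%:R :> R by rewrite ler_nat.
  move=> /(ler_wpM2r (ltW e0)); lra.
move: (2 / m.+2%:R) p2 big => r p2 big.
have := ler_wpM2l (ltW C0) p2; have := ler_wpM2l (ltW C0) p1.
have := le_trans (ler_dist_dist (f u) (g u)) (hg u u1).
by rewrite ghu !ler_norml => /andP[? ?] ? ?; apply/andP; split; lra.
Qed.

Lemma approximable_max f g : approximable f -> approximable g ->
  approximable (fun u => Num.max (f u) (g u)).
Proof.
move=> af ag; have -> : (fun u => Num.max (f u) (g u)) =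
    (fun u => 2^-1 * (f u + g u + `|f u + - 1 * g u|)).
  by apply/funext => u; rewrite maxr_absE mulN1r mulrC.
apply: approximableZ; apply: approximableD; first exact: approximableD.
by apply: approximable_abs; apply: approximableD => //; exact: approximableZ.
Qed.

(** The support function of a finite net of [K] is a maximum of finitely many
    linear functions, and maxima reduce to absolute values. *)
Lemma approximable_support K : convex_body K -> approximable (support K).
Proof.
move=> bK e e0; have [[p0 Kp0] cK _] := bK.
have e20 : 0 < e / 2 by rewrite divr_gt0.
have [s sK net] := compact_net cK e20.
pose F (r : seq 'rV[R]_n) u := foldr (fun p c => Num.max (dot p u) c) (dot p0 u) r.
have aF r : approximable (F r).
  elim: r => [|p r IH] /=.
    apply: approximable_tame; have := tame_dot p0.
    by congr tame; apply/funext => u; exact: dotC.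
  apply: approximable_max IH; apply: approximable_tame; have := tame_dot p.
  by congr tame; apply/funext => u; exact: dotC.
have F_le r u : (forall p, p \in r -> K p) -> F r u <= support K u.
  elim: r => [|p r IH] rK /=; first exact: dot_le_support.
  rewrite ge_max dot_le_support //; last by apply: rK; rewrite mem_head.
  by apply: IH => q qr; apply: rK; rewrite inE qr orbT.
have le_F r p u : p \in r -> dot p u <= F r u.
  elim: r => [|q r IH] //=; rewrite inE le_max => /orP[/eqP ->|/IH ->].
    by rewrite lexx.
  by rewrite orbT.
have [f tf hf] := aF s _ e20; exists f => // u u1.
have [p Kp [pE _]] := support_attained u bK.
have [q qs pq] := net p Kp.
have : dot p u <= dot q u + e / 2.
  rewrite -lerBlDl -dotBl; apply: le_trans (dot_le_enorm _ _) _.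
  by rewrite u1 mulr1.
have := hf u u1; have := F_le s u sK; have := le_F s q u qs; rewrite -pE.
by rewrite !ler_norml => ? ? /andP[? ?] ?; apply/andP; split; lra.
Qed.

Lemma cauchy_averages_support D Hs k K : family_F D ->
  (forall m, proper_subspace (Hs m)) -> stable D Hs -> convex_body K ->
  uniformly_cauchy (fun m => averages Hs k m (support K)).
Proof.
move=> fD pH st bK e e0; have e30 : 0 < e / 3 by rewrite divr_gt0.
have [f tf hf] := approximable_support bK e30.
have [N hN] := tame_cauchy k fD pH st tf e30; exists N => i j Ni Nj u u1.
have h1 : averages Hs k i (support K) u <= averages Hs k i f u + e / 3.
  apply: averages_le u1 => v v1; have := hf v v1.
  by rewrite ler_norml => /andP[? ?]; lra.
have h2 : averages Hs k j f u <= averages Hs k j (support K) u + e / 3.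
  apply: averages_le u1 => v v1; have := hf v v1.
  by rewrite ler_norml => /andP[? ?]; lra.
have := hN i j Ni Nj u u1; lra.
Qed.

End Density.
(** * Minkowski and Steiner symmetrization *)

Section ClassicalSymmetrizations.
Variables (R : realType) (n : nat).
Implicit Types (x y u v w p q : 'rV[R]_n) (A K L : set 'rV[R]_n) (c d e t : R).
Implicit Types (H : {vspace 'rV[R]_n}) (Hs : nat -> {vspace 'rV[R]_n}).

Lemma minkowski_symmetric H K : symmetric_wrt H (minkowski_symmetral H K).
Proof.
rewrite minkowski_symmetralE; apply: symmetric_wrtP => _ [[p q] [/= Kp Kq] <-].
by exists (q, p) => //=; rewrite reflectionZ reflectionD reflectionK addrC.
Qed.

Lemma minkowski_translate_sub H K x : convex_body K -> symmetric_wrt H K ->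
  x \in perp H -> minkowski_symmetral H [set y + x | y in K] `<=` K.
Proof.
move=> [_ _ /convex_setP vK] sK xp; rewrite minkowski_symmetralE.
move=> _ [[_ _] [/= [p Kp <-] [q Kq <-]] <-].
have -> : 2^-1 *: (p + x + reflection H (q + x)) =
    2^-1 *: p + (1 - 2^-1) *: reflection H q.
  rewrite reflectionD (reflection_perp xp).
  by apply/rowP => i; rewrite !mxE; field.
apply: vK => //; last exact: symmetric_wrt_mem.
by rewrite invf_le1 // ler1n.
Qed.

Lemma family_F_minkowski : family_F (@minkowski_symmetral R n).
Proof.
have trans H : perp_translation_invariant_at minkowski_symmetral H.
  move=> K bK sK x xp; apply/seteqP; split; first exact: minkowski_translate_sub.
  move=> y Ky; rewrite minkowski_symmetralE.
  exists (y + x, reflection H y + x).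
    split; [by exists y | exists (reflection H y) => //; exact: symmetric_wrt_mem].
  rewrite /= reflectionD reflectionK (reflection_perp xp).
  by apply/rowP => i; rewrite !mxE; field.
split=> [H pH K bK|H pH].
  by split; [exact: minkowski_body | exact: minkowski_symmetric].
split=> [K L _ _ KL|//|K bK sK].
  rewrite !minkowski_symmetralE => _ [[p q] [/= Kp Kq] <-]; exists (p, q) => //.
  by split; exact: KL.
have := trans H K bK sK 0 (mem0v _).
have -> : [set y + 0 | y in K] = K; last by [].
by apply/seteqP; split=> [_ [y Ky <-]|y Ky]; [rewrite addr0 | exists y; rewrite ?addr0].
Qed.

(** Restricting the pairs of the Minkowski symmetral to a common fiber
    [x + perp H] gives, in every dimension of [H], a symmetrization that is
    Steiner's when [H] is a hyperplane. *)
Definition fiber_symmetral : set_operation R n := fun H K =>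
  [set 2^-1 *: (z.1 + reflection H z.2) | z in
    (K `*` K) `&` [set z | z.1 - z.2 \in perp H]].

Lemma fiber_sub_minkowski H K : fiber_symmetral H K `<=` minkowski_symmetral H K.
Proof. by rewrite minkowski_symmetralE => _ [z [Kz _] <-]; exists z. Qed.

Lemma pairB_continuous :
  continuous (fun z : 'rV[R]_n * 'rV[R]_n => (z.1 - z.2 : 'rV[R]_n)).
Proof.
move=> -[p q].
have c1 : {for (p, q), continuous (@fst 'rV[R]_n 'rV[R]_n)} by exact: cvg_fst.
have c2 : {for (p, q), continuous (@snd 'rV[R]_n 'rV[R]_n)} by exact: cvg_snd.
exact: (cvgB c1 c2).
Qed.

Lemma closed_perp H : closed [set x | x \in perp H].
Proof.
have -> : [set x | x \in perp H] = \bigcap_(v in [set v | v \in H]) [set x | dot x v = 0].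
  apply/seteqP; split=> x h; first by move=> v; exact: perp_dot h.
  by apply/mem_perpP => v; exact: h.
apply: closed_bigI => v _.
apply: (@preimage_closed _ _ (fun x => dot x v) [set 0]); last exact: closed_eq.
by move=> x _; exact: dotl_continuous.
Qed.

Lemma fiber_body H K : convex_body K -> convex_body (fiber_symmetral H K).
Proof.
move=> [[x Kx] cK /convex_setP vK].
apply: pair_image_body => [||p q p' q' t t0 t1 [[/= ? ?] pq] [[/= ? ?] pq']].
- by exists (x, x); split=> //=; rewrite subrr mem0v.
- apply: compact_closedI; first exact: compact_setX.
  apply: (@preimage_closed _ _ (fun z : 'rV[R]_n * 'rV[R]_n => z.1 - z.2)
    [set x | x \in perp H]); last exact: closed_perp.
  by move=> z _; exact: pairB_continuous.
- split; first by split=> /=; exact: vK.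
  rewrite /= opprD addrACA -!scalerBr.
  by rewrite rpredD // rpredZ.
Qed.

Lemma fiber_mem H K p q : K p -> K q -> p - q \in perp H ->
  fiber_symmetral H K (2^-1 *: (p + reflection H q)).
Proof. by move=> Kp Kq pq; exists (p, q). Qed.

Lemma family_F_fiber : family_F fiber_symmetral.
Proof.
have trans H : perp_translation_invariant_at fiber_symmetral H.
  move=> K bK sK x xp; apply/seteqP; split.
    by apply: subset_trans (@fiber_sub_minkowski _ _) _; exact: minkowski_translate_sub.
  move=> y Ky.
  have -> : y = 2^-1 *: (y + x + reflection H (reflection H y + x)).
    rewrite reflectionD reflectionK (reflection_perp xp).
    by apply/rowP => i; rewrite !mxE; field.
  apply: fiber_mem; first by exists y.
    by exists (reflection H y) => //; exact: symmetric_wrt_mem.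
  by rewrite opprD addrACA subrr addr0 sub_reflection_perp.
split=> [H pH K bK|H pH]; first split; first exact: fiber_body.
  apply: symmetric_wrtP => _ [[p q] [[/= Kp Kq] pq] <-].
  rewrite reflectionZ reflectionD reflectionK addrC.
  by apply: fiber_mem => //; rewrite -opprB rpredN.
split=> [K L _ _ KL|//|K bK sK].
  by move=> _ [[p q] [[/= Kp Kq] pq] <-]; apply: fiber_mem => //; exact: KL.
have := trans H K bK sK 0 (mem0v _).
have -> : [set y + 0 | y in K] = K; last by [].
by apply/seteqP; split=> [_ [y Ky <-]|y Ky]; [rewrite addr0 | exists y; rewrite ?addr0].
Qed.

Lemma perp_hyperplane_line H v w : hyperplane H -> v \in perp H -> v != 0 ->
  w \in perp H -> exists t, w = t *: v.
Proof.
move=> [/andP[H1 _] Hn] vp v0 wp.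
have dimp : \dim (perp H) = 1%N.
  have := dimv_disjoint_sum (perp_cap H).
  rewrite perp_add dimvf /dim /= mul1n Hn => nE.
  have n0 : (0 < n)%N by rewrite Hn in H1; case: (n) H1.
  by apply/eqP; rewrite -(eqn_add2r n.-1) -nE add1n prednK.
have /eqP pE : (<[v]> == perp H)%VS.
  by rewrite eqEdim dim_vline v0 dimp andbT -memvE.
by move: wp; rewrite -pE => /vlineP[t ->]; exists t.
Qed.

Lemma diameter_attained A : A !=set0 -> compact A ->
  exists p q, [/\ A p, A q & diameter A = enorm (p - q)] /\
    forall p' q', A p' -> A q' -> enorm (p' - q') <= diameter A.
Proof.
move=> [a Aa] cA.
have AA0 : (A `*` A) !=set0 by exists (a, a).
have [|[p q] /set_mem[/= Ap Aq] pqmax] := @compact_EVT_max _ R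
    (fun z : 'rV[R]_n * 'rV[R]_n => enorm (z.1 - z.2)) _ AA0 (compact_setX cA cA).
  apply: continuous_subspaceT => z.
  exact: (continuous_comp (@pairB_continuous z) (@enorm_continuous R n _)).
have ub : ubound [set enorm (p - q) | p in A & q in A] (enorm (p - q)).
  by move=> _ [p' Ap' [q' Aq' <-]]; apply: (pqmax (p', q')); rewrite inE.
have dE : diameter A = enorm (p - q).
  apply/eqP; rewrite eq_le; apply/andP; split.
    by apply: ge_sup => //; exists (enorm (p - q)), p => //; exists q.
  by apply: ub_le_sup; [exists (enorm (p - q)) | exists p => //; exists q].
exists p, q; split=> // p' q' Ap' Aq'; rewrite dE; apply: ub.
by exists p' => //; exists q'.
Qed.

(** The perpendicular sections of [K] are segments. A point at distance at most
    half of the length of such a segment from [H] is the midpoint of [p'] and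
    [R q'] for the ends [p'] and [q'] of a subsegment; conversely such a midpoint
    is at distance [|p' - q'| / 2] from [H]. *)
Lemma steiner_fiber H K : hyperplane H -> convex_body K ->
  steiner_symmetral H K = fiber_symmetral H K.
Proof.
move=> hH bK; have [_ cK /convex_setP vK] := bK.
have cS x : compact (perp_section H K x).
  apply: compact_closedI => //.
  apply: (@preimage_closed _ _ (fun y => y - x) [set y | y \in perp H]);
    last exact: closed_perp.
  by move=> y _; exact: (cvgB cvg_id (cvg_cst x)).
have midE x p q : x \in H -> q - x \in perp H ->
    2^-1 *: (p + reflection H q) = x + 2^-1 *: (p - q).
  move=> xH qx; have -> : reflection H q = x - (q - x).
    by rewrite -{1}(subrK x q) reflectionD (reflection_perp qx) (reflection_sub xH) addrC.
  by apply/rowP => i; rewrite !mxE; field.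
apply/seteqP; split=> y.
  move=> [x [xH S0 yx dy]].
  have [p [q [[[Kp px] [Kq qx] dE] _]]] := diameter_attained S0 (cS x).
  rewrite /= in px qx; rewrite dE in dy.
  have pq : p - q \in perp H.
    by have := rpredB px qx; rewrite opprB addrA subrK.
  have [t tE t1] : exists2 t, y - x = t *: (p - q) & `|t| <= 1 / 2.
    have [pq0|pq0] := eqVneq (p - q) 0.
      exists 0; last by rewrite normr0.
      rewrite scale0r; apply: enorm_eq0; apply/eqP; rewrite eq_le enorm_ge0 andbT.
      by rewrite pq0 enorm0 mul0r in dy.
    have [t tE] := perp_hyperplane_line hH pq pq0 yx; exists t => //.
    have n0 : 0 < enorm (p - q).
      by rewrite lt_def enorm_ge0 andbT; apply: contraNneq pq0 => /enorm_eq0 ->.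
    by rewrite -(ler_pM2r n0) -enormZ -tE mulrAC mul1r.
  (* a subsegment of the longest chord that has twice the offset of [y] *)
  have sub s a b : 0 <= s -> s <= 1 -> K a -> K b -> a - x \in perp H ->
      b - x \in perp H -> y - x = (s / 2) *: (a - b) -> fiber_symmetral H K y.
    move=> s0 s1 Ka Kb ax bx e1.
    have ab : a - b \in perp H by have := rpredB ax bx; rewrite opprB addrA subrK.
    have -> : y = 2^-1 *: (s *: a + (1 - s) *: b + reflection H b).
      rewrite (midE x) // -[y](subrK x) e1.
      by apply/rowP => i; rewrite !mxE; field.
    apply: fiber_mem => //; first exact: vK.
    have -> : s *: a + (1 - s) *: b - b = s *: (a - b).
      by apply/rowP => i; rewrite !mxE; ring.
    exact: rpredZ.
  have [t0|t0] := lerP 0 t.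
    rewrite ger0_norm // in t1.
    apply: (sub (2 * t) p q) => //; [lra | lra |].
    by rewrite tE; congr (_ *: _); field.
  rewrite ltr0_norm // in t1.
  apply: (sub (- (2 * t)) q p) => //; [lra | lra |].
  by rewrite tE; apply/rowP => i; rewrite !mxE; field.
move=> [[p q] [[/= Kp Kq] pq] <-].
set x := p - proj_perp H p.
have xH : x \in H by exact: sub_proj_perp.
have px : p - x \in perp H by rewrite /x subKr mem_proj_perp.
have qx : q - x \in perp H.
  have -> : q - x = (p - x) - (p - q) by apply/rowP => i; rewrite !mxE; ring.
  exact: rpredB.
exists x; rewrite (midE x) //; split=> //; first by exists p.
  by rewrite addrC addKr rpredZ.
have [p' [q' [_ dmax]]] := diameter_attained (ex_intro _ p (conj Kp px)) (cS x).
rewrite addrC addKr enormZ ger0_norm // mulrC ler_wpM2r //.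
exact: dmax.
Qed.

Lemma stable_steiner_fiber Hs : (forall m, hyperplane (Hs m)) ->
  stable steiner_symmetral Hs <-> stable fiber_symmetral Hs.
Proof.
move=> hH.
have sE k K : convex_body K ->
    successive steiner_symmetral Hs k K = successive fiber_symmetral Hs k K.
  move=> bK; apply/funext => j.
  have [//] : successive steiner_symmetral Hs k K j =
    successive fiber_symmetral Hs k K j /\ convex_body (successive fiber_symmetral Hs k K j).
  elim: j => [|j [IH1 IH2]] /=.
    by rewrite steiner_fiber //; split=> //; exact: fiber_body.
  by rewrite IH1 steiner_fiber //; split=> //; exact: fiber_body.
by split=> st k K bK; have [L bL cL] := st k K bK; exists L => //;
  [rewrite -sE | rewrite sE].
Qed.

End ClassicalSymmetrizations.
Theorem theorem1p4 (R : realType) (n : nat) :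
  (forall D : set_operation R n, family_F D ->
     forall Hs : nat -> {vspace 'rV[R]_n},
       (forall m, proper_subspace (Hs m)) -> stable D Hs ->
       forall E : set_operation R n, family_F E -> stable E Hs)
  /\
  (forall Hs : nat -> {vspace 'rV[R]_n},
     (forall m, hyperplane (Hs m)) ->
     (stable steiner_symmetral Hs <-> stable minkowski_symmetral Hs)).
Proof.
have main (D : set_operation R n) : family_F D ->
     forall Hs : nat -> {vspace 'rV[R]_n},
       (forall m, proper_subspace (Hs m)) -> stable D Hs ->
       forall E : set_operation R n, family_F E -> stable E Hs.
  move=> fD Hs pH st E fE; apply: stable_of_cauchy_averages => // k K bK.
  exact: (cauchy_averages_support k fD pH st bK).
split=> [//|Hs hH]; have pH m : proper_subspace (Hs m) by have [] := hH m.
rewrite stable_steiner_fiber //; split=> st.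
  exact: main (@family_F_fiber R n) _ pH st _ (@family_F_minkowski R n).
exact: main (@family_F_minkowski R n) _ pH st _ (@family_F_fiber R n).
Qed.
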